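(* Let $1<m<\infty$ and let $(M^n,g,u^{2-m-n}\,\mathrm{dvol}_g)$ be a compact quasi-Einstein smooth metric measure space (with dimensional parameter $2-m-n$), with quasi-Einstein constant $\mu$ and characteristic constant $\lambda>0$. Then the scalar curvature $R$ of $g$ satisfies $$-\frac{n(n-1)}{m-1}\mu<R\leq(m+2n-2)\mu .$$
   Context: For finite $k\neq0$, a smooth metric measure space with dimensional parameter $k$ is a four-tuple $(M^n,g,w^k\,\mathrm{dvol}_g,k)$ of a (connected, boundaryless) Riemannian manifold, a positive function $w\in C^\infty(M)$ and $k\in\mathbb{R}$; write $w^k=e^{-\phi}$. It is quasi-Einstein with quasi-Einstein constant $c$ if $\mathrm{Ric}_\phi^k:=\mathrm{Ric}-kw^{-1}\nabla^2w=c\,g$. Its characteristic constant is then the constant $d$ such that $R_\phi^k+k\,d\,w^{-2}=(k+n)c$, where $R_\phi^k=R+2\Delta\phi-\frac{k+1}{k}|\nabla\phi|^2$. In the statement $k=2-m-n$, $w=u$, $c=\mu$, $d=\lambda$. *)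

(* Defs.v *)
From HB Require Import structures.
From mathcomp Require Import all_boot all_order all_algebra.
From mathcomp Require Import all_classical all_reals all_analysis.
Set Implicit Arguments.
Unset Strict Implicit.
Unset Printing Implicit Defensive.
Import Order.TTheory GRing.Theory Num.Theory.
Import numFieldNormedType.Exports.
Local Open Scope classical_set_scope.
Local Open Scope ring_scope.

Definition partial (R : realType) (n : nat) (i : 'I_n) (f : 'rV[R]_n -> R)
  (x : 'rV[R]_n) : R := 'D_(delta_mx 0 i) f x.

Fixpoint iter_partial (R : realType) (n : nat) (s : seq 'I_n)
    (f : 'rV[R]_n -> R) : 'rV[R]_n -> R :=
  if s is i :: s' then partial i (iter_partial s' f) else f.

Definition smooth_on (R : realType) (n : nat) (U : set 'rV[R]_n)
    (f : 'rV[R]_n -> R) : Prop :=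
  forall (s : seq 'I_n) (x : 'rV[R]_n), U x ->
    {for x, continuous (iter_partial s f)} /\
    (forall i : 'I_n, derivable (iter_partial s f) x (delta_mx 0 i)).

(* Only the values of [chart_map] on [chart_dom] and of [chart_inv] on        *)
(* [chart_cod] are meaningful. Charts have open images in R^n, so manifolds   *)
(* have no boundary.                                                          *)
Record chart (R : realType) (n : nat) (M : topologicalType) := Chart {
  chart_dom : set M;
  chart_cod : set 'rV[R]_n;
  chart_map : M -> 'rV[R]_n;
  chart_inv : 'rV[R]_n -> M;
  chart_dom_open : open chart_dom;
  chart_cod_open : open chart_cod;
  chart_map_cod : forall p, chart_dom p -> chart_cod (chart_map p);
  chart_inv_dom : forall x, chart_cod x -> chart_dom (chart_inv x);
  chart_mapK : forall p, chart_dom p -> chart_inv (chart_map p) = p;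
  chart_invK : forall x, chart_cod x -> chart_map (chart_inv x) = x;
  chart_map_continuous : {within chart_dom, continuous chart_map};
  chart_inv_continuous : {within chart_cod, continuous chart_inv} }.

Definition overlap (R : realType) (n : nat) (M : topologicalType)
    (a b : chart R n M) : set 'rV[R]_n :=
  [set x | chart_cod a x /\ chart_dom b (chart_inv a x)].

Definition transition (R : realType) (n : nat) (M : topologicalType)
    (a b : chart R n M) (x : 'rV[R]_n) : 'rV[R]_n :=
  chart_map b (chart_inv a x).

Record smooth_manifold (R : realType) (n : nat) := SmoothManifold {
  points :> topologicalType;
  manifold_hausdorff : hausdorff_space points;
  manifold_second_countable : @second_countable points;
  atlas : set (chart R n points);
  atlas_cover : forall p : points, exists2 a, atlas a & chart_dom a p;
  atlas_smooth : forall a b, atlas a -> atlas b -> forall k : 'I_n,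
    smooth_on (overlap a b) (fun x => transition a b x 0 k) }.

Definition smooth (R : realType) (n : nat) (M : smooth_manifold R n)
    (f : M -> R) : Prop :=
  forall a, atlas a -> smooth_on (chart_cod a) (f \o chart_inv a).

(* A Riemannian metric is given by its component matrices in the charts of    *)
(* the atlas, which transform as a covariant 2-tensor.                        *)
Record riemannian_manifold (R : realType) (n : nat) := RiemannianManifold {
  manifold :> smooth_manifold R n;
  manifold_connected : connected [set: manifold];
  metric : chart R n manifold -> 'rV[R]_n -> 'M[R]_n;
  metric_smooth : forall a, atlas a -> forall i j : 'I_n,
    smooth_on (chart_cod a) (fun x => metric a x i j);
  metric_sym : forall a, atlas a -> forall x, chart_cod a x ->
    (metric a x)^T = metric a x;
  metric_posdef : forall a, atlas a -> forall x, chart_cod a x ->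
    forall v : 'rV[R]_n, v != 0 -> 0 < (v *m metric a x *m v^T) 0 0;
  metric_tensor : forall a b, atlas a -> atlas b ->
    forall x, overlap a b x -> forall i j : 'I_n,
    metric a x i j =
      \sum_(k < n) \sum_(l < n)
        partial i (fun y => transition a b y 0 k) x *
        partial j (fun y => transition a b y 0 l) x *
        metric b (transition a b x) k l }.

(* [christoffel g k i j x] is Gamma^k_{ij}, where [g] is the component matrix of *)
(* the metric in a chart.                                                     *)
Definition christoffel (R : realType) (n : nat) (g : 'rV[R]_n -> 'M[R]_n)
    (k i j : 'I_n) (x : 'rV[R]_n) : R :=
  2^-1 * \sum_(l < n) invmx (g x) k l *
    (partial i (fun y => g y j l) x + partial j (fun y => g y i l) x
     - partial l (fun y => g y i j) x).

(* The component R^l_{kij}, i.e. R(d_i, d_j) d_k = sum_l R^l_{kij} d_l where  *)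
(* R(X, Y) = [nabla_X, nabla_Y] - nabla_{[X, Y]}.                             *)
Definition riemann (R : realType) (n : nat) (g : 'rV[R]_n -> 'M[R]_n)
    (l k i j : 'I_n) (x : 'rV[R]_n) : R :=
  partial i (christoffel g l j k) x - partial j (christoffel g l i k) x
  + \sum_(p < n) (christoffel g l i p x * christoffel g p j k x
                  - christoffel g l j p x * christoffel g p i k x).

(* Ric(Y, Z) = tr (X |-> R(X, Y) Z), which is positive on round spheres. *)
Definition ricci (R : realType) (n : nat) (g : 'rV[R]_n -> 'M[R]_n)
    (x : 'rV[R]_n) : 'M[R]_n :=
  \matrix_(j, k) \sum_(i < n) riemann g i k i j x.

Definition metric_trace (R : realType) (n : nat) (g : 'rV[R]_n -> 'M[R]_n)
    (x : 'rV[R]_n) (A : 'M[R]_n) : R :=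
  \sum_(i < n) \sum_(j < n) invmx (g x) i j * A i j.

Definition hessian (R : realType) (n : nat) (g : 'rV[R]_n -> 'M[R]_n)
    (f : 'rV[R]_n -> R) (x : 'rV[R]_n) : 'M[R]_n :=
  \matrix_(i, j) (partial i (partial j f) x
                  - \sum_(k < n) christoffel g k i j x * partial k f x).

Definition laplacian (R : realType) (n : nat) (g : 'rV[R]_n -> 'M[R]_n)
    (f : 'rV[R]_n -> R) (x : 'rV[R]_n) : R :=
  metric_trace g x (hessian g f x).

Definition grad_norm2 (R : realType) (n : nat) (g : 'rV[R]_n -> 'M[R]_n)
    (f : 'rV[R]_n -> R) (x : 'rV[R]_n) : R :=
  metric_trace g x (\matrix_(i, j) (partial i f x * partial j f x)).

(* The scalar curvature at the point with coordinates [x] in the chart [a]. *)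
Definition scalar_curvature (R : realType) (n : nat)
    (M : riemannian_manifold R n) (a : chart R n M) (x : 'rV[R]_n) : R :=
  metric_trace (metric a) x (ricci (metric a) x).

Record smooth_metric_measure_space (R : realType) (n : nat) (k : R) :=
  SmoothMetricMeasureSpace {
  space :> riemannian_manifold R n;
  density : space -> R;
  dim_param_neq0 : k != 0;
  density_smooth : smooth density;
  density_gt0 : forall p, 0 < density p }.

(* [wc] and [phic] are [w] and [phi] in the chart [a], with w^k = e^{-phi}. *)
Definition wc (R : realType) (n : nat) (k : R)
    (X : smooth_metric_measure_space n k) (a : chart R n X) (x : 'rV[R]_n) : R
  := density (chart_inv a x).

Definition phic (R : realType) (n : nat) (k : R)
    (X : smooth_metric_measure_space n k) (a : chart R n X) (x : 'rV[R]_n) : R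
  := - ln (wc a x `^ k).

Definition weighted_ricci (R : realType) (n : nat) (k : R)
    (X : smooth_metric_measure_space n k) (a : chart R n X) (x : 'rV[R]_n)
    : 'M[R]_n :=
  ricci (metric a) x - (k * (wc a x)^-1) *: hessian (metric a) (wc a) x.

Definition weighted_scalar_curvature (R : realType) (n : nat) (k : R)
    (X : smooth_metric_measure_space n k) (a : chart R n X) (x : 'rV[R]_n)
    : R :=
  scalar_curvature a x + 2 * laplacian (metric a) (phic a) x
  - (k + 1) / k * grad_norm2 (metric a) (phic a) x.

Definition quasi_einstein (R : realType) (n : nat) (k : R)
    (X : smooth_metric_measure_space n k) (c : R) : Prop :=
  forall a : chart R n X, atlas a -> forall x, chart_cod a x ->
    weighted_ricci a x = c *: metric a x.

Definition characteristic_constant (R : realType) (n : nat) (k : R)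
    (X : smooth_metric_measure_space n k) (c d : R) : Prop :=
  forall a : chart R n X, atlas a -> forall x, chart_cod a x ->
    weighted_scalar_curvature a x + k * d * (wc a x) ^- 2 = (k + n%:R) * c.

(* Main.v *)
(** Write w for the density, F = |dw|^2, D = Delta w, N = m + n - 1. Tracing the
quasi-Einstein equation and using the characteristic constant gives
w D = lambda - mu w^2 + N F and
R = (m + 2n - 2) mu - N (N - 1) (F + lambda/N) / w^2, so the upper bound is
immediate and the lower bound says that (F + lambda/N) / w^2 < mu/(m - 1).
At a maximum of w the first identity gives mu > 0.
The weak maximum principle for (F + lambda/N) / w^2 only gives the non-strict
inequality. If the strict one fails at q, maximize instead
(F + lambda/N) / w^2 + e w^s for a large exponent s and a small e > 0: at the
maximum point, where the value T satisfies T >= mu/(m - 1) + e w(q)^s, the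
function F + lambda/N + e w^(s+2) - T w^2 has a maximum equal to 0, and
Bochner's formula for F, with |Hess w|^2 >= D^2/n, yields a contradiction. The
extra term thus replaces the strong maximum principle. *)

From HB Require Import structures.
Require Import Defs.
From mathcomp Require Import all_boot all_order all_algebra.
From mathcomp Require Import all_classical all_reals all_analysis.
From mathcomp Require Import ring lra.
Set Implicit Arguments.
Unset Strict Implicit.
Unset Printing Implicit Defensive.
Import Order.TTheory GRing.Theory Num.Theory.
Import numFieldNormedType.Exports.
Local Open Scope classical_set_scope.
Local Open Scope ring_scope.

(** * Functions of several variables *)

(** Without the extra term the argument stops at an equality: with [e = 0], [w^2] times Bochner's
    inequality at the maximum reads [2 (m - 1) / n * (w D) * y <= 0] with
    [y = (T - mu / (m - 1)) w^2], which says nothing when [T = mu / (m - 1)]. The term [e w^s] adds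
    a positive quantity there, and a large [s] lets that quantity outweigh the slightly negative
    values of [y] that the perturbation allows. Third derivatives of w disappear for two reasons. At
    a critical point of [F + p(w)] the differential of F is [- p'(w) dw], so Hess w maps the
    gradient of w to a multiple of [dw]. Differentiating the identity for [w D] makes [dD] a
    multiple of [dw] as well. Every term of Bochner's formula other than [|Hess w|^2] is then an
    expression in w, F and D, and a rational inequality in real numbers remains. The constant
    [mu / (m - 1)] comes from [(m + 2n - 2) + n (n - 1) / (m - 1) = N (N - 1) / (m - 1)]. *)

Section Line.
Context {R : realType} {V : normedModType R}.

Lemma is_derive_line (f : V -> R) (x v : V) (s t : R) :
  derivable f (x + (t * s) *: v) v ->
  is_derive t (1 : R) (fun u => f (x + (u * s) *: v))
    (s * 'D_v f (x + (t * s) *: v)).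
Proof.
move=> df.
set y := x + _ in df *.
pose F (h : R) : R := f (h *: v + y).
pose A (u : R) : R := (u - t) * s.
have -> : (fun u => f (x + (u * s) *: v)) = F \o A.
  by apply/funext => u /=; rewrite /F /A /y addrCA -scalerDl mulrBl subrK.
have At : A t = 0 by rewrite /A subrr mul0r.
have dF : derivable F (A t) 1 by rewrite At; exact: (derivable1P _ _ _).1 df.
have dA : is_derive t (1 : R) A s.
  have -> : A = s *: (id - cst t) by apply/funext => u; rewrite /A mulrC.
  by apply: is_derive_eq; rewrite subr0 [_ *: _]mulr1.
have dA' : derivable A t 1 := @ex_derive _ _ _ _ _ _ _ dA.
have F0 : 'D_1 F 0 = 'D_v f y.
  rewrite /derive; set g1 := fun h => _ *: _; set g2 := fun h => _ *: _.
  have -> // : g1 = g2.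
  by apply/funext => h; rewrite /g1 /g2 /F /= addr0 scale0r add0r [_%:A]mulr1.
split.
  apply: (derivable1_diffP (F \o A) t).2.
  exact: differentiable_comp ((derivable1_diffP A t).1 dA')
    ((derivable1_diffP F (A t)).1 dF).
rewrite -derive1E (derive1_comp dA' dF) !derive1E At F0 mulrC.
by rewrite (@derive_val _ _ _ _ _ _ _ dA).
Qed.

(** The signed length [s] is kept apart from the parameter [t] in [0, 1], so that a step of either
    sign, such as a coordinate of an increment, needs no case analysis. *)
Lemma mvt_line (f : V -> R) (x v : V) (s : R) :
  (forall t : R, 0 <= t <= 1 -> derivable f (x + (t * s) *: v) v) ->
  exists t : R, [/\ 0 < t, t < 1 &
    f (x + s *: v) - f x = s * 'D_v f (x + (t * s) *: v)].
Proof.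
move=> df.
have dg (t : R) : 0 <= t <= 1 ->
    is_derive t (1 : R) (fun u => f (x + (u * s) *: v))
    (s * 'D_v f (x + (t * s) *: v)).
  by move=> /df/is_derive_line.
have [||t t01] := @MVT R (fun u => f (x + (u * s) *: v))
   (fun t => s * 'D_v f (x + (t * s) *: v)) 0 1 ltr01.
- by move=> t /[!in_itv] /= /andP[t0 t1]; apply: dg; rewrite !ltW.
- by apply: derivable_within_continuous => t; rewrite in_itv /= => /dg [].
rewrite mul1r mul0r scale0r addr0 subr0 mulr1 => ->.
by move: t01; rewrite in_itv /= => /andP[t0 t1]; exists t.
Qed.
End Line.

Lemma half_dist_eq (R : realFieldType) (a b c : R) :
  `|a - c| < `|a - b| / 2 -> `|b - c| < `|a - b| / 2 -> a = b.
Proof.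
move=> ac bc; have : `|a - b| < `|a - b|; last by rewrite ltxx.
rewrite {2}(splitr `|a - b|) (le_lt_trans (ler_distD c _ _))//.
by rewrite ltrD// distrC.
Qed.

(** * Symmetry of second derivatives *)

Section Schwarz.
Context {R : realType} {V : normedModType R}.

Lemma derive_shiftE (f : V -> R) (c x v : V) :
  'D_v (fun y => f (y + c)) x = 'D_v f (x + c).
Proof. by rewrite /derive; under eq_fun do rewrite /= -addrA. Qed.

Lemma derivable_shiftE (f : V -> R) (c x v : V) :
  derivable f (x + c) v -> derivable (fun y => f (y + c)) x v.
Proof. by rewrite /derivable => df; under eq_fun do rewrite /= -addrA. Qed.

(** The mean value theorem is applied twice: along [u] to [f (y + s *: v) - f y], then along [v] to
    the derivative of [f] in the direction [u]. *)
Lemma second_difference (f : V -> R) (x u v : V) (s : R) :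
  (forall a b : R, 0 <= a <= 1 -> 0 <= b <= 1 ->
    derivable f (x + (a * s) *: u + (b * s) *: v) u /\
    derivable ('D_u f) (x + (a * s) *: u + (b * s) *: v) v) ->
  exists a b : R, [/\ 0 <= a <= 1, 0 <= b <= 1 &
    f (x + s *: u + s *: v) - f (x + s *: u) - (f (x + s *: v) - f x) =
    s * (s * 'D_v ('D_u f) (x + (a * s) *: u + (b * s) *: v))].
Proof.
move=> df.
pose phi (y : V) : R := f (y + s *: v) - f y.
have dphi (a : R) : 0 <= a <= 1 ->
    is_derive (x + (a * s) *: u) u phi
     ('D_u f (x + (a * s) *: u + s *: v) - 'D_u f (x + (a * s) *: u)).
  move=> a01.
  have [d1 _] := df a 1 a01 ltac:(by rewrite ler01 lexx).
  have [d0 _] := df a 0 a01 ltac:(by rewrite ler01 lexx).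
  rewrite mul1r in d1; rewrite mul0r scale0r addr0 in d0.
  have d1' := derivable_shiftE d1.
  split; first exact: (derivableB d1' d0).
  by rewrite (deriveB d1' d0) derive_shiftE.
have [a [/ltW a0 /ltW a1 Ea]] := @mvt_line _ _ phi x u s
  (fun a a01 => @ex_derive _ _ _ _ _ _ _ (dphi a a01)).
have a01 : 0 <= a <= 1 by rewrite a0.
have [b [/ltW b0 /ltW b1 Eb]] :=
  @mvt_line _ _ ('D_u f) (x + (a * s) *: u) v s (fun b b01 => (df a b a01 b01).2).
exists a, b; split => //; first by rewrite b0.
by rewrite -Eb -(@derive_val _ _ _ _ _ _ _ (dphi a a01)) -Ea /phi.
Qed.

(** The second difference over a small parallelogram is symmetric in [u] and [v], so the two mixed
    derivatives take a common value at two points near [x]. By continuity at [x] they cannot differ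
    there. *)
Lemma derive_comm (U : set V) (f : V -> R) (x u v : V) : open U -> U x ->
  (forall y, U y -> [/\ derivable f y u, derivable f y v,
    derivable ('D_u f) y v & derivable ('D_v f) y u]) ->
  {for x, continuous ('D_u ('D_v f))} -> {for x, continuous ('D_v ('D_u f))} ->
  'D_u ('D_v f) x = 'D_v ('D_u f) x.
Proof.
move=> oU Ux df cuv cvu;
set A : R := 'D_u ('D_v f) x; set B : R := 'D_v ('D_u f) x.
have [//|neq] := eqVneq A B.
pose e := `|A - B| / 2.
have e0 : 0 < e by rewrite divr_gt0// normr_gt0 subr_eq0.
have nuv : \forall y \near x, `|A - 'D_u ('D_v f) y| < e.
  exact: ((cvgrPdist_lt _ _).1 cuv e e0).
have nvu : \forall y \near x, `|B - 'D_v ('D_u f) y| < e.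
  exact: ((cvgrPdist_lt _ _).1 cvu e e0).
have /nbhs_ballP[d /= d0 Hd] : \forall y \near x, [/\ U y,
    `|A - 'D_u ('D_v f) y| < e & `|B - 'D_v ('D_u f) y| < e].
  have nU : \forall y \near x, U y by exact: open_nbhs_nbhs.
  by apply: filterS3 nU nuv nvu => y.
(* With this side length the whole parallelogram lies in the ball of radius [d]; the [+ 1] keeps the
   denominator positive and the bound strict. *)
pose s := d / (`|u| + `|v| + 1).
have M0 : 0 < `|u| + `|v| + 1 by rewrite ltr_wpDl// addr_ge0.
have s0 : 0 < s by rewrite divr_gt0.
have inB (a b : R) : 0 <= a <= 1 -> 0 <= b <= 1 ->
    ball x d (x + (a * s) *: u + (b * s) *: v).
  move=> /andP[a0 a1] /andP[b0 b1].
  rewrite -ball_normE /ball_/= -addrA opprD addrA subrr sub0r normrN.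
  apply: (@le_lt_trans _ _ (s * (`|u| + `|v|))); last first.
    by rewrite /s mulrAC ltr_pdivrMr// ltr_pM2l// ltrDl.
  rewrite (le_trans (ler_normD _ _))// mulrDr.
  by rewrite lerD// normrZ ler_wpM2r// ger0_norm ?mulr_ge0 ?ler_piMl// ltW.
have inB' (a b : R) : 0 <= a <= 1 -> 0 <= b <= 1 ->
    ball x d (x + (a * s) *: v + (b * s) *: u).
  by move=> a01 b01; rewrite addrAC; apply: inB.
have [a [b [a01 b01 E1]]] : exists a b : R, [/\ 0 <= a <= 1, 0 <= b <= 1 &
    f (x + s *: u + s *: v) - f (x + s *: u) - (f (x + s *: v) - f x) =
    s * (s * 'D_v ('D_u f) (x + (a * s) *: u + (b * s) *: v))].
  apply: second_difference => a b a01 b01.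
  by have [/df[]] := Hd _ (inB a b a01 b01).
have [a' [b' [a01' b01' E2]]] : exists a b : R, [/\ 0 <= a <= 1, 0 <= b <= 1 &
    f (x + s *: v + s *: u) - f (x + s *: v) - (f (x + s *: u) - f x) =
    s * (s * 'D_u ('D_v f) (x + (a * s) *: v + (b * s) *: u))].
  apply: second_difference => a' b' a01' b01'.
  by have [/df[]] := Hd _ (inB' a' b' a01' b01').
have E : 'D_v ('D_u f) (x + (a * s) *: u + (b * s) *: v) =
    'D_u ('D_v f) (x + (a' * s) *: v + (b' * s) *: u).
  apply: (mulfI (lt0r_neq0 s0)); apply: (mulfI (lt0r_neq0 s0)).
  have swap (p q r t : R) : p - q - (r - t) = p - r - (q - t) by ring.
  have Eq : x + s *: v + s *: u = x + s *: u + s *: v := addrAC _ _ _.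
  rewrite Eq in E2.
  exact: etrans (esym E1) (etrans (swap _ _ _ _) E2).
have [_ _ H1] := Hd _ (inB a b a01 b01).
have [_ H2 _] := Hd _ (inB' a' b' a01' b01').
rewrite E in H1; exact: half_dist_eq H2 H1.
Qed.
End Schwarz.

(** * Differentiability from continuous partial derivatives *)

Section C1.
Context {R : realType} {n : nat}.
Implicit Types f : 'rV[R]_n -> R.

Lemma coord_norm_le (v : 'rV[R]_n) (i : 'I_n) : `|v 0 i| <= `|v|.
Proof.
rewrite [leRHS]/Num.Def.normr/= mx_normrE.
exact: (le_bigmax _ (fun ij : 'I_1 * 'I_n => `|v ij.1 ij.2|) (0, i)).
Qed.

Lemma rV_norm_le (v : 'rV[R]_n) (a : R) : 0 <= a ->
  (forall i, `|v 0 i| <= a) -> `|v| <= a.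
Proof.
move=> a0 H; rewrite [leLHS]/Num.Def.normr/= mx_normrE.
by apply: bigmax_le => //= -[i j] _ /=; rewrite ord1.
Qed.

(** The increment is split into steps parallel to the axes, and the mean value theorem replaces each
    step by a partial derivative at a nearby point. *)
Lemma C1_increment f (U : set 'rV[R]_n) (x : 'rV[R]_n) (e : R) :
  open U -> U x -> 0 < e ->
  (forall y, U y -> forall i, derivable f y (delta_mx 0 i)) ->
  (forall i, {for x, continuous (partial i f)}) ->
  \forall h \near (0 : 'rV[R]_n),
    `|f (h + x) - (f x + \sum_i h 0 i * partial i f x)| <= e * `|h|.
Proof.
move=> oU Ux e0 df cf.
(* Each of the [n] steps may cost [e']; dividing by [n.+1] also covers [n = 0]. *)
pose e' := e / n.+1%:R.
have e'0 : 0 < e' by rewrite divr_gt0.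
have /nbhs_ballP[d /= d0 Hd] : \forall y \near x, U y /\
    forall i, `|partial i f x - partial i f y| < e'.
  apply: filterI; first exact: open_nbhs_nbhs.
  have K i : \forall y \near x, `|partial i f x - partial i f y| < e'.
    exact: ((cvgrPdist_lt _ _).1 (cf i) e' e'0).
  exact: (@filter_forall _ _ (fun i y => `|partial i f x - partial i f y| < e')
    (nbhs x) _ K).
apply/nbhs_ballP; exists d => //= h; rewrite -ball_normE /ball_/= sub0r normrN => hd.
(* A path from 0 to [h] that switches on one coordinate at a time. In the sup norm none of its
   points is longer than [h], so it stays in the ball. *)
pose hk (k : nat) : 'rV[R]_n := \row_j (if (j < k)%N then h 0 j else 0).
have h0 : hk 0%N = 0 by apply/rowP => j; rewrite !mxE.
have hn : hk n = h by apply/rowP => j; rewrite !mxE ltn_ord.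
have hS (k : 'I_n) : hk k.+1 = hk k + h 0 k *: delta_mx 0 k.
  apply/rowP => j; rewrite !mxE eqxx /= ltnS leq_eqVlt -val_eqE /=.
  by case: ltngtP => // [jk|jk|/val_inj ->]; rewrite ?mulr0 ?mulr1 ?addr0 ?add0r.
have step (k : 'I_n) : `|f (x + hk k.+1) - f (x + hk k) -
    h 0 k * partial k f x| <= e' * `|h|.
  have inB (t : R) : 0 <= t <= 1 ->
      ball x d (x + hk k + (t * h 0 k) *: delta_mx 0 k).
    move=> /andP[t0 t1].
    rewrite -ball_normE /ball_/= -addrA opprD addrA subrr sub0r normrN.
    apply: le_lt_trans hd; apply: rV_norm_le => // j; rewrite !mxE eqxx /=.
    have [->|jk] := eqVneq j k.
      rewrite ltnn add0r mulr1 normrM (ger0_norm t0).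
      by rewrite (le_trans _ (coord_norm_le h k))// ler_piMl.
    rewrite mulr0 addr0; case: ifP => _; first exact: coord_norm_le.
    by rewrite normr0.
  have [|t [/ltW t0 /ltW t1 E]] := @mvt_line _ _ f (x + hk k) (delta_mx 0 k) (h 0 k).
    by move=> t t01; apply: df; have [] := Hd _ (inB t t01).
  rewrite hS addrA E -mulrBr normrM mulrC ler_pM//; last exact: coord_norm_le.
  by rewrite distrC ltW//; have [_] := Hd _ (inB t (introT andP (conj t0 t1))); apply.
have -> : f (h + x) - (f x + \sum_i h 0 i * partial i f x) =
    \sum_(k < n) (f (x + hk k.+1) - f (x + hk k) - h 0 k * partial k f x).
  rewrite sumrB opprD addrA; congr (_ - _).
  rewrite -(big_mkord xpredT (fun k => f (x + hk k.+1) - f (x + hk k))).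
  rewrite (@telescope_sumr _ _ _ (fun k => f (x + hk k)))//.
  by rewrite h0 hn addr0 [x + h]addrC.
rewrite (le_trans (ler_norm_sum _ _ _))//.
rewrite (le_trans (ler_sum _ (fun k _ => step k)))//.
rewrite sumr_const card_ord -mulr_natr mulrAC ler_wpM2r//.
by rewrite /e' -mulrA ler_piMr ?ltW// mulrC ltr_pdivrMr// mul1r ltr_nat.
Qed.

(** [smooth_on] speaks only of the coordinate directions. Arbitrary directions and changes of charts
    require the full differential, which is obtained here. *)
Lemma C1_differentiable f (U : set 'rV[R]_n) (x : 'rV[R]_n) :
  open U -> U x ->
  (forall y, U y -> forall i, derivable f y (delta_mx 0 i)) ->
  (forall i, {for x, continuous (partial i f)}) ->
  differentiable f x /\
  forall v, 'D_v f x = \sum_i v 0 i * partial i f x.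
Proof.
move=> oU Ux df cf.
pose d (v : 'rV[R]_n) : R := \sum_i v 0 i * partial i f x.
have lin_d : linear d.
  move=> a u v; rewrite /d scaler_sumr -big_split; apply: eq_bigr => i _ /=.
  by rewrite !mxE mulrDl -mulrA.
have [dL dLE] : exists dL : {linear 'rV[R]_n -> R}, dL = d :> (_ -> _).
  pose dM := GRing.isLinear.Build _ _ _ _ _ lin_d.
  by pose dL : {linear 'rV[R]_n -> R} := HB.pack d dM; exists dL.
have cd : continuous dL.
  move=> v; apply: differentiable_continuous.
  have -> : (dL : _ -> _) = \sum_i (fun v : 'rV[R]_n => v 0 i *: partial i f x).
    by rewrite dLE; apply/funext => w; rewrite fct_sumE.
  apply: differentiable_sum => i; apply: differentiableZl.
  exact: differentiable_coord.
have E : (f \o shift x : 'rV[R]_n -> R) = cst (f x) + dL +o_ (0 : 'rV[R]_n) id.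
  by apply/eqaddoP => e e0; rewrite dLE; exact: (C1_increment oU Ux e0 df cf).
have D := diff_unique cd E.
have dfx : differentiable f x by apply/diff_locallyP; rewrite D.
by split => // v; rewrite deriveE// D dLE.
Qed.
End C1.

(** * Smooth functions on an open set *)

Section Smooth.
Context {R : realType} {n : nat}.
Implicit Types (U : set 'rV[R]_n) (f g : 'rV[R]_n -> R) (i j : 'I_n).

Lemma iter_partial_rcons (s : seq 'I_n) i f :
  iter_partial (rcons s i) f = iter_partial s (partial i f).
Proof. by elim: s => //= j s ->. Qed.

Lemma smooth_on_partial U f i : smooth_on U f -> smooth_on U (partial i f).
Proof. by move=> sf s x Ux; rewrite -iter_partial_rcons; exact: sf. Qed.

Lemma smooth_on_continuous U f x : smooth_on U f -> U x ->
  {for x, continuous f}.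
Proof. by move=> sf Ux; have [] := sf [::] x Ux. Qed.

Lemma smooth_on_derivable U f x i : smooth_on U f -> U x ->
  derivable f x (delta_mx 0 i).
Proof. by move=> sf Ux; have [_] := sf [::] x Ux; apply. Qed.

Lemma eq_on_near U f g x : open U -> U x ->
  (forall y, U y -> f y = g y) -> \forall y \near x, f y = g y.
Proof.
move=> oU Ux fg; have nU : \forall y \near x, U y by exact: open_nbhs_nbhs.
by apply: filterS nU => y /fg.
Qed.

Lemma eq_on_partial U f g x i : open U -> U x ->
  (forall y, U y -> f y = g y) -> partial i f x = partial i g x.
Proof. by move=> oU Ux fg; exact: near_eq_derive (eq_on_near oU Ux fg). Qed.

Lemma eq_on_continuous U f g x : open U -> U x ->
  (forall y, U y -> f y = g y) -> {for x, continuous f} ->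
  {for x, continuous g}.
Proof.
move=> oU Ux fg cf; rewrite /prop_for /continuous_at -(fg x Ux).
apply: cvg_trans cf; exact: near_eq_cvg (eq_on_near oU Ux fg).
Qed.

(** A coinduction principle for smoothness: one order of regularity suffices for a class that is
    stable under partial derivatives. Stability is asked only up to equality on [U], since rules
    such as that for the inverse hold only there. *)
Lemma smooth_on_closed U (P : ('rV[R]_n -> R) -> Prop) : open U ->
  (forall f, P f -> forall x, U x -> {for x, continuous f} /\
    forall i, derivable f x (delta_mx 0 i)) ->
  (forall f i, P f -> exists2 g, P g & forall x, U x -> partial i f x = g x) ->
  forall f, P f -> smooth_on U f.
Proof.
move=> oU P0 P1 f Pf s x Ux.
have [g Pg fg] : exists2 g, P g & forall x, U x -> iter_partial s f x = g x.
  elim: s => [|i s [g Pg fg]] /=; first by exists f.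
  have [h Ph gh] := P1 g i Pg; exists h => // y Uy.
  by rewrite -gh//; exact: eq_on_partial fg.
have gf y : U y -> g y = iter_partial s f y by move=> /fg.
have [cg dg] := P0 g Pg x Ux; split; first exact: eq_on_continuous oU Ux gf cg.
by move=> i; exact: near_eq_derivable (eq_on_near oU Ux gf) (dg i).
Qed.

Lemma eq_on_smooth U f g : open U -> (forall y, U y -> f y = g y) ->
  smooth_on U f -> smooth_on U g.
Proof.
move=> oU fg sf.
apply: (smooth_on_closed (P := fun h => exists2 f, smooth_on U f &
    forall y, U y -> f y = h y) oU) => [h [h' sh' hh'] x Ux|h i [h' sh' hh']|].
- split=> [|i].
    exact: eq_on_continuous oU Ux hh' (smooth_on_continuous sh' Ux).
  exact: near_eq_derivable (eq_on_near oU Ux hh') (smooth_on_derivable sh' Ux).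
- exists (partial i h') => [|x Ux]; last by rewrite (eq_on_partial i oU Ux hh').
  by exists (partial i h'); [exact: smooth_on_partial|move=> y _].
- by exists f.
Qed.

Lemma partialD f g x i : derivable f x (delta_mx 0 i) ->
  derivable g x (delta_mx 0 i) ->
  partial i (fun y => f y + g y) x = partial i f x + partial i g x.
Proof. exact: deriveD. Qed.

Lemma partialM f g x i : derivable f x (delta_mx 0 i) ->
  derivable g x (delta_mx 0 i) ->
  partial i (fun y => f y * g y) x = partial i f x * g x + f x * partial i g x.
Proof.
move=> df dg; apply: etrans (deriveM df dg) _; rewrite addrC.
by congr (_ + _); exact: mulrC.
Qed.

Lemma partialV f x i : f x != 0 -> derivable f x (delta_mx 0 i) ->
  partial i (fun y => (f y)^-1) x = - ((f x)^-1 * ((f x)^-1 * partial i f x)).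
Proof.
move=> fx df; apply: etrans (deriveV fx df) _.
by rewrite scaleNr expr2 invfM -scalerA.
Qed.

Lemma partial_cst (a : R) x i : partial i (fun _ => a) x = 0.
Proof. exact: derive_cst. Qed.

(* This class is stable under partial derivatives, so that [smooth_on_closed] *)
(* makes all its members smooth.                                              *)
Inductive smooth_closure U : ('rV[R]_n -> R) -> Prop :=
| SmoothBase f : smooth_on U f -> smooth_closure U f
| SmoothCst a : smooth_closure U (fun _ => a)
| SmoothAdd f g : smooth_closure U f -> smooth_closure U g ->
    smooth_closure U (fun x => f x + g x)
| SmoothMul f g : smooth_closure U f -> smooth_closure U g ->
    smooth_closure U (fun x => f x * g x)
| SmoothInv f : (forall x, U x -> f x != 0) -> smooth_closure U f ->
    smooth_closure U (fun x => (f x)^-1).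

Lemma smooth_closure_derivable U f : smooth_closure U f -> forall x, U x ->
  {for x, continuous f} /\ forall i, derivable f x (delta_mx 0 i).
Proof.
elim=> {f} [f sf|a|f g _ IHf _ IHg|f g _ IHf _ IHg|f f0 _ IHf] x Ux.
- exact: sf [::] x Ux.
- by split; [exact: cst_continuous|move=> i; exact: derivable_cst].
- have [cf df] := IHf x Ux; have [cg dg] := IHg x Ux; split.
    exact: (cvgD cf cg).
  by move=> i; exact: derivableD (df i) (dg i).
- have [cf df] := IHf x Ux; have [cg dg] := IHg x Ux; split.
    exact: (cvgM cf cg).
  by move=> i; exact: derivableM (df i) (dg i).
- have [cf df] := IHf x Ux; split; first exact: (cvgV (f0 x Ux) cf).
  by move=> i; exact: derivableV (f0 x Ux) (df i).
Qed.

Lemma smooth_closure_partial U f i : smooth_closure U f ->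
  exists2 g, smooth_closure U g & forall x, U x -> partial i f x = g x.
Proof.
elim=> {f} [f sf|a|f g sf [f' sf' ff'] sg [g' sg' gg']
  |f g sf [f' sf' ff'] sg [g' sg' gg']|f f0 sf [f' sf' ff']].
- by exists (partial i f) => //; apply: SmoothBase; exact: smooth_on_partial.
- by exists (fun=> 0) => [|x _]; [exact: SmoothCst|exact: partial_cst].
- exists (fun x => f' x + g' x); first exact: SmoothAdd.
  move=> x Ux; have [_ df] := smooth_closure_derivable sf Ux.
  by have [_ dg] := smooth_closure_derivable sg Ux; rewrite partialD// ff'// gg'.
- exists (fun x => f' x * g x + f x * g' x).
    by apply: SmoothAdd; exact: SmoothMul.
  move=> x Ux; have [_ df] := smooth_closure_derivable sf Ux.
  by have [_ dg] := smooth_closure_derivable sg Ux; rewrite partialM// ff'// gg'.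
- exists (fun x => -1 * ((f x)^-1 * ((f x)^-1 * f' x))).
    apply: SmoothMul; first exact: SmoothCst.
    by apply: SmoothMul; [|apply: SmoothMul] => //; exact: SmoothInv.
  move=> x Ux; have [_ df] := smooth_closure_derivable sf Ux.
  by rewrite partialV ?f0// ff'// mulN1r.
Qed.

Lemma smooth_closure_smooth U f : open U -> smooth_closure U f -> smooth_on U f.
Proof.
move=> oU; apply: smooth_on_closed => // {}f; first exact: smooth_closure_derivable.
by move=> i; exact: smooth_closure_partial.
Qed.

Section open_domain.
Context {U : set 'rV[R]_n} (oU : open U).

Lemma smooth_on_cst (a : R) : smooth_on U (fun _ => a).
Proof. by apply: smooth_closure_smooth => //; exact: SmoothCst. Qed.

Lemma smooth_onD f g : smooth_on U f -> smooth_on U g ->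
  smooth_on U (fun x => f x + g x).
Proof.
move=> sf sg; apply: smooth_closure_smooth => //.
by apply: SmoothAdd; exact: SmoothBase.
Qed.

Lemma smooth_onM f g : smooth_on U f -> smooth_on U g ->
  smooth_on U (fun x => f x * g x).
Proof.
move=> sf sg; apply: smooth_closure_smooth => //.
by apply: SmoothMul; exact: SmoothBase.
Qed.

Lemma smooth_onV f : (forall x, U x -> f x != 0) -> smooth_on U f ->
  smooth_on U (fun x => (f x)^-1).
Proof.
move=> f0 sf; apply: smooth_closure_smooth => //.
by apply: SmoothInv => //; exact: SmoothBase.
Qed.

Lemma smooth_onN f : smooth_on U f -> smooth_on U (fun x => - f x).
Proof.
move=> sf; under eq_fun do rewrite -mulN1r.
exact: smooth_onM (smooth_on_cst _) sf.
Qed.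

Lemma smooth_onB f g : smooth_on U f -> smooth_on U g ->
  smooth_on U (fun x => f x - g x).
Proof. by move=> sf sg; exact: smooth_onD sf (smooth_onN sg). Qed.

Lemma smooth_on_sum (I : Type) (r : seq I) (P : pred I) (F : I -> 'rV[R]_n -> R) :
  (forall k, P k -> smooth_on U (F k)) ->
  smooth_on U (fun x => \sum_(k <- r | P k) F k x).
Proof.
move=> sF; elim: r => [|k r IH].
  by under eq_fun do rewrite big_nil; exact: smooth_on_cst.
have [Pk|/negbTE Pk] := boolP (P k); under eq_fun do rewrite big_cons Pk.
  exact: smooth_onD (sF k Pk) IH.
exact: IH.
Qed.

Lemma smooth_on_prod (I : Type) (r : seq I) (P : pred I) (F : I -> 'rV[R]_n -> R) :
  (forall k, P k -> smooth_on U (F k)) ->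
  smooth_on U (fun x => \prod_(k <- r | P k) F k x).
Proof.
move=> sF; elim: r => [|k r IH].
  by under eq_fun do rewrite big_nil; exact: smooth_on_cst.
have [Pk|/negbTE Pk] := boolP (P k); under eq_fun do rewrite big_cons Pk.
  exact: smooth_onM (sF k Pk) IH.
exact: IH.
Qed.

Lemma smooth_on_horner (p : {poly R}) f : smooth_on U f ->
  smooth_on U (fun x => p.[f x]).
Proof.
move=> sf; elim/poly_ind: p => [|p c IH].
  by under eq_fun do rewrite horner0; exact: smooth_on_cst.
under eq_fun do rewrite hornerMXaddC.
exact: smooth_onD (smooth_onM IH sf) (smooth_on_cst _).
Qed.

Lemma partial_horner (p : {poly R}) f x i : smooth_on U f -> U x ->
  partial i (fun y => p.[f y]) x = p^`().[f x] * partial i f x.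
Proof.
move=> sf Ux; elim/poly_ind: p => [|p c IH].
  under eq_fun do rewrite horner0.
  by rewrite partial_cst deriv0 horner0 mul0r.
under eq_fun do rewrite hornerMXaddC.
have df := smooth_on_derivable (i := i) sf Ux.
have dp := smooth_on_derivable (i := i) (smooth_on_horner p sf) Ux.
rewrite partialD ?partial_cst; last exact: derivable_cst.
  by rewrite partialM// IH derivMXaddC hornerD hornerMX; ring.
by apply: smooth_on_derivable Ux; exact: smooth_onM (smooth_on_horner p sf) sf.
Qed.

Lemma partial_sum (I : Type) (r : seq I) (P : pred I) (F : I -> 'rV[R]_n -> R) x i :
  U x -> (forall k, P k -> smooth_on U (F k)) ->
  partial i (fun y => \sum_(k <- r | P k) F k y) x =
  \sum_(k <- r | P k) partial i (F k) x.
Proof.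
move=> Ux sF; elim: r => [|k r IH].
  under eq_fun do rewrite big_nil; by rewrite big_nil partial_cst.
rewrite big_cons; have [Pk|/negbTE Pk] := boolP (P k);
  under eq_fun do rewrite big_cons Pk; last exact: IH.
rewrite partialD ?IH//; first exact: smooth_on_derivable (sF k Pk) Ux.
by apply: smooth_on_derivable Ux; exact: smooth_on_sum.
Qed.

Lemma partialC f x i j : smooth_on U f -> U x ->
  partial i (partial j f) x = partial j (partial i f) x.
Proof.
move=> sf Ux; apply: (derive_comm oU Ux).
- move=> y Uy; split; [exact: smooth_on_derivable sf Uy..| |].
    exact: smooth_on_derivable (smooth_on_partial i sf) Uy.
  exact: smooth_on_derivable (smooth_on_partial j sf) Uy.
- by apply: smooth_on_continuous Ux; do 2 apply: smooth_on_partial.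
- by apply: smooth_on_continuous Ux; do 2 apply: smooth_on_partial.
Qed.

Lemma smooth_on_differentiable f x : smooth_on U f -> U x ->
  differentiable f x /\ forall v, 'D_v f x = \sum_i v 0 i * partial i f x.
Proof.
move=> sf Ux; apply: (C1_differentiable oU Ux).
  by move=> y Uy i; exact: smooth_on_derivable sf Uy.
by move=> i; apply: smooth_on_continuous Ux; exact: smooth_on_partial.
Qed.

Lemma local_max_partial f x i : smooth_on U f -> U x ->
  (forall y, U y -> f y <= f x) -> partial i f x = 0.
Proof.
move=> sf Ux fmax.
pose c (t : R) : 'rV[R]_n := x + (t * 1) *: delta_mx 0 i.
have c0 : c 0 = x by rewrite /c mul0r scale0r addr0.
have cc : {for 0, continuous c}.
  apply: cvgD; first exact: cvg_cst.
  by apply: cvgZr_tmp; apply: cvgMr_tmp; exact: cvg_id.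
have [d /= d0 Hd] : exists2 d : R, 0 < d & forall t, `|t| < d -> U (c t).
  have : nbhs (c 0) U by rewrite c0; exact: open_nbhs_nbhs.
  move=> /cc /nbhs_ballP[d /= d0 Hd]; exists d => // t td; apply: Hd.
  by rewrite -ball_normE /ball_/= sub0r normrN.
have dc t : `|t| < d -> is_derive t (1 : R) (f \o c) (1 * partial i f (c t)).
  move=> td; apply: is_derive_line.
  exact: smooth_on_derivable sf (Hd t td).
have itv t : t \in `](- d), d[%R -> `|t| < d.
  by rewrite in_itv /= ltr_norml.
have D0 : is_derive (0 : R) (1 : R) (f \o c) 0.
  apply: (@derive1_at_max _ _ (- d) d).
  - by rewrite ge0_cp// ltW.
  - by move=> t /itv/dc[].
  - by rewrite in_itv /= oppr_lt0 d0.
  - by move=> t /itv/Hd/fmax; rewrite /= c0.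
have := @derive_val _ _ _ _ _ _ _ D0.
have /dc D1 : `|0 : R| < d by rewrite normr0.
by rewrite (@derive_val _ _ _ _ _ _ _ D1) mul1r c0.
Qed.

(** The sum is the derivative along [v] of [psi], the derivative of [f] along [v], and [psi]
    vanishes at [x]. If it were positive, [psi] would be positive shortly after [x] on the line, and
    the mean value theorem would make [f] exceed its maximum. *)
Lemma local_max_second_derivative f x (v : 'rV[R]_n) : smooth_on U f -> U x ->
  (forall y, U y -> f y <= f x) ->
  \sum_i \sum_j v 0 i * v 0 j * partial i (partial j f) x <= 0.
Proof.
move=> sf Ux fmax.
pose psi y := \sum_j v 0 j * partial j f y.
have spsi : smooth_on U psi.
  apply: smooth_on_sum => j _.
  exact: smooth_onM (smooth_on_cst _) (smooth_on_partial j sf).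
have -> : \sum_i \sum_j v 0 i * v 0 j * partial i (partial j f) x = 'D_v psi x.
  have [_ ->] := smooth_on_differentiable spsi Ux; apply: eq_bigr => i _.
  rewrite partial_sum; [|exact: Ux|]; last first.
    by move=> j _; exact: smooth_onM (smooth_on_cst _) (smooth_on_partial j sf).
  rewrite mulr_sumr; apply: eq_bigr => j _.
  rewrite partialM ?partial_cst ?mul0r ?add0r ?mulrA//.
  exact: smooth_on_derivable (smooth_on_partial j sf) Ux.
have psi0 : psi x = 0.
  by rewrite /psi big1// => j _; rewrite (local_max_partial j sf Ux fmax) mulr0.
rewrite leNgt; apply/negP => c0.
have dpsi : derivable psi x v.
  by apply: diff_derivable; exact: (smooth_on_differentiable spsi Ux).1.
(* The difference quotients of [psi] tend to a positive [l], and a number at distance less than [l]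
   from [l] is positive. *)
have /nbhs_ballP[d /= d0 Hd] : \forall h \near (0 : R), h != 0 ->
    0 < h^-1 * psi (h *: v + x).
  have := dpsi => /cvg_ex[/= l Hl].
  have l0 : 0 < l by rewrite -(cvg_lim _ Hl).
  have nl : \forall h \near (0 : R), h != 0 ->
      `|l - h^-1 *: (psi (h *: v + x) - psi x)| < l.
    exact: (cvgrPdist_lt _ _).1 Hl l l0.
  apply: filterS nl => h Hh /Hh; rewrite psi0 subr0 => /ltr_distlBl.
  by rewrite subrr.
have nU : nbhs (0 *: v + x) U by rewrite scale0r add0r; exact: open_nbhs_nbhs.
have cl : {for 0, continuous (fun h : R => h *: v + x)}.
  by apply: cvgD; [exact: scalel_continuous|exact: cvg_cst].
have /nbhs_ballP[e /= e0 He] := cl _ nU.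
pose s := Num.min d e / 2.
have s0 : 0 < s by rewrite divr_gt0// lt_min d0.
have sd : s < Num.min d e by rewrite ltr_pdivrMr// ltr_pMr ?lt_min ?d0// ltr1n.
move: sd; rewrite lt_min => /andP[sd se]; clearbody s.
have inU (t : R) : 0 <= t <= 1 -> U (x + (t * s) *: v).
  move=> /andP[t0 t1]; rewrite addrC; apply: He.
  rewrite -ball_normE /ball_/= sub0r normrN ger0_norm; last exact: mulr_ge0 t0 (ltW s0).
  by rewrite (le_lt_trans _ se)// ler_piMl// ltW.
have [|t [t0 t1 E]] := @mvt_line _ _ f x v s.
  by move=> t /inU Ut; apply: diff_derivable; exact: (smooth_on_differentiable sf Ut).1.
have Ut : U (x + (t * s) *: v) by apply: inU; rewrite !ltW.
have [_ Dv] := smooth_on_differentiable sf Ut.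
have ts0 : 0 < t * s by exact: mulr_gt0.
have psit : 0 < psi (x + (t * s) *: v).
  rewrite addrC -(pmulr_rgt0 _ (_ : 0 < (t * s)^-1)) ?invr_gt0//.
  apply: Hd; last by rewrite gt_eqF.
  rewrite -ball_normE /ball_/= sub0r normrN gtr0_norm//.
  by rewrite (lt_trans _ sd)// gtr_pMl.
have : f (x + s *: v) <= f x.
  by apply: fmax; have := inU 1; rewrite mul1r; apply; rewrite ler01 lexx.
by rewrite -subr_le0 E Dv leNgt mulr_gt0.
Qed.
End open_domain.

(** Restricting [phi] to the line through [x] in direction [i] gives a curve, for which derivability
    is differentiability; hence only the partial derivatives of [phi] in that one direction are
    needed. *)
Lemma partial_comp (f : 'rV[R]_n -> R) (phi : 'rV[R]_n -> 'rV[R]_n) x i :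
  differentiable f (phi x) ->
  (forall k, derivable (fun y => phi y 0 k) x (delta_mx 0 i)) ->
  partial i (f \o phi) x =
  'd f (phi x) (\row_k partial i (fun y => phi y 0 k) x).
Proof.
move=> df dphi.
have dphi' : derivable phi x (delta_mx 0 i).
  by apply/derivable_mxP => a k; rewrite ord1.
have Dphi : 'D_(delta_mx 0 i) phi x = \row_k partial i (fun y => phi y 0 k) x.
  by rewrite derive_mx//; apply/rowP => k; rewrite !mxE.
rewrite -Dphi.
pose c (t : R) := phi (t *: delta_mx 0 i + x).
have c0 : c 0 = phi x by rewrite /c scale0r add0r.
have dc : derivable c 0 1 := (derivable1P _ _ _).1 dphi'.
have Dline (W : normedModType R) (g : 'rV[R]_n -> W) :
    'D_(delta_mx 0 i) g x = 'D_1 (fun t : R => g (t *: delta_mx 0 i + x)) 0.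
  rewrite /derive; set g1 := fun h => _ *: _; set g2 := fun h => _ *: _.
  have -> // : g1 = g2.
  by apply/funext => h; rewrite /g1 /g2 /= addr0 scale0r add0r [_%:A]mulr1.
have dc' : differentiable c 0 := (derivable1_diffP _ _).1 dc.
have dfc : differentiable f (c 0) by rewrite c0.
rewrite /partial !Dline.
transitivity ('D_1 (f \o c) 0) => //.
rewrite (deriveE _ (differentiable_comp dc' dfc)) diff_comp// /=.
by rewrite -(deriveE _ dc') c0.
Qed.
End Smooth.

(** * Positive definite matrices *)

Section PosDef.
Context {R : rcfType}.

Definition posdef_mx n (A : 'M[R]_n) : Prop :=
  A^T = A /\ forall v : 'rV[R]_n, v != 0 -> 0 < (v *m A *m v^T) 0 0.

Lemma posdef_unitmx n (A : 'M[R]_n) : posdef_mx A -> A \in unitmx.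
Proof.
move=> [_ A0]; rewrite -row_free_unit; apply/row_freeP.
suff K : kermx A = 0.
  have : row_free A by rewrite -kermx_eq0 K.
  by move/row_freeP.
apply/eqP/rowV0P => v vA; have {}vA : v *m A = 0 by apply/sub_kermxP.
apply/eqP/negPn/negP => /A0.
by rewrite vA mul0mx mxE ltxx.
Qed.

Lemma posdef_invmx n (A : 'M[R]_n) : posdef_mx A -> posdef_mx (invmx A).
Proof.
move=> pA; have uA := posdef_unitmx pA; case: pA => sA A0.
have sI : (invmx A)^T = invmx A by rewrite trmx_inv sA.
split=> // v v0.
have -> : v *m invmx A *m v^T = (v *m invmx A) *m A *m (v *m invmx A)^T.
  by rewrite mulmxKV// trmx_mul sI mulmxA.
apply: A0; apply: contra_neq v0 => vA.
by rewrite -(mulmxKV uA v) vA mul0mx.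
Qed.

Lemma posdef_cholesky n (A : 'M[R]_n) : posdef_mx A -> exists E : 'M[R]_n, A = E^T *m E.
Proof.
elim: n A => [|n IH] A; first by exists 0; apply/matrixP => -[].
rewrite -[n.+1]/(1 + n)%N in A * => -[sA A0].
pose a := A 0 0; pose b : 'rV[R]_n := ursubmx A; pose D := drsubmx A.
have EA : A = block_mx a%:M b b^T D.
  rewrite -[LHS]submxK; congr block_mx; last by rewrite trmx_ursub sA.
  by apply/matrixP => i j; rewrite !ord1 !mxE /= mulr1n; congr (A _ _); apply/val_inj.
have sD : D^T = D by rewrite /D trmx_drsub sA.
have quad (x : R) (v : 'rV[R]_n) :
    (row_mx x%:M v *m A *m (row_mx x%:M v)^T) 0 0 =
    x * x * a + x *+ 2 * (v *m b^T) 0 0 + (v *m D *m v^T) 0 0.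
  rewrite EA mul_row_block tr_row_mx mul_row_col !mulmxDl -!scalar_mxM.
  rewrite tr_scalar_mx !mul_scalar_mx !mul_mx_scalar -scalemxAl.
  have eD (B C : 'M[R]_1) : (B + C) 0 0 = B 0 0 + C 0 0 by rewrite mxE.
  have eZ y (B : 'M[R]_1) : (y *: B) 0 0 = y * B 0 0 by rewrite mxE.
  rewrite !eD !eZ mxE.
  have -> : (b *m v^T) 0 0 = (v *m b^T) 0 0.
    by rewrite -[v in RHS]trmxK -trmx_mul [in RHS]mxE.
  by rewrite mulr1n; ring.
have a0 : 0 < a.
  have Z : (0 : 'M[R]_1) 0 0 = 0 by rewrite mxE.
  have := A0 (row_mx 1%:M 0); rewrite quad !mul0mx !Z mulr0 !addr0 !mul1r.
  apply; apply/eqP => /(congr1 lsubmx); rewrite row_mxKl => /matrixP/(_ 0 0)/eqP.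
  by rewrite !mxE oner_eq0.
have [|E' EE'] := IH (D - a^-1 *: (b^T *m b)).
  split; first by rewrite linearB linearZ /= sD trmx_mul trmxK.
  move=> v v0.
  (* This first coordinate minimizes the quadratic form for a fixed [v], and the minimum is the
     Schur complement evaluated at [v]. *)
  have := A0 (row_mx (- (a^-1 * (v *m b^T) 0 0))%:M v); rewrite quad => H.
  rewrite mulmxBr mulmxBl -scalemxAr -scalemxAl.
  have -> : v *m (b^T *m b) *m v^T = (v *m b^T) *m (v *m b^T)^T.
    by rewrite trmx_mul trmxK !mulmxA.
  set c := v *m b^T in H *.
  have -> : (v *m D *m v^T - a^-1 *: (c *m c^T)) 0 0 =
      (v *m D *m v^T) 0 0 - a^-1 * (c 0 0 * c 0 0).
    by rewrite !mxE big_ord1 !mxE.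
  suff : 0 < - (a^-1 * c 0 0) * - (a^-1 * c 0 0) * a
      + - (a^-1 * c 0 0) *+ 2 * c 0 0 + (v *m D *m v^T) 0 0.
    by congr (0 < _); field; rewrite gt_eqF.
  apply: H; apply: contra_neq v0 => /(congr1 rsubmx).
  by rewrite row_mxKr => ->; apply/matrixP => i j; rewrite !mxE.
pose r := Num.sqrt a.
have rr : r * r = a by rewrite -expr2 sqr_sqrtr// ltW.
have r0 : r != 0 by rewrite gt_eqF// sqrtr_gt0.
exists (block_mx r%:M (r^-1 *: b) 0 E').
rewrite tr_block_mx mulmx_block !trmx0 !mul0mx !mulmx0 !addr0 EA.
rewrite tr_scalar_mx -scalar_mxM rr mul_scalar_mx mul_mx_scalar.
have -> : (r^-1 *: b)^T = r^-1 *: b^T by rewrite linearZ.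
rewrite -scalemxAl -scalemxAr !scalerA mulfV// !scale1r -invfM rr.
by rewrite -EE' addrC subrK.
Qed.

Lemma mxtrace_prod n (A B : 'M[R]_n) : B^T = B ->
  \tr (A *m B) = \sum_i \sum_j A i j * B i j.
Proof.
move=> sB; apply: eq_bigr => i _; rewrite mxE; apply: eq_bigr => j _.
by rewrite -{1}sB mxE.
Qed.

(** With [P = E^T *m E], the trace is the sum of the values of the form [A] on the rows of [E]. *)
Lemma posdef_trace_le0 n (P A : 'M[R]_n) : posdef_mx P ->
  (forall v : 'rV[R]_n, (v *m A *m v^T) 0 0 <= 0) -> \tr (P *m A) <= 0.
Proof.
move=> /posdef_cholesky[E ->] H.
rewrite -mulmxA mxtrace_mulC; apply: sumr_le0 => i _.
have := H (row i E); congr (_ <= 0).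
by rewrite -row_mul !mxE; apply: eq_bigr => k _; rewrite !mxE.
Qed.

(** For [P] the inverse metric and [H] the Hessian this is the bound of the squared Laplacian by n
    times the squared norm of the Hessian. In the frame [E] it follows by dropping the off-diagonal
    entries of [S] and applying Cauchy-Schwarz to the diagonal. *)
Lemma posdef_trace_sqr n (P H : 'M[R]_n) : posdef_mx P -> H^T = H ->
  \tr (P *m H) ^+ 2 <= n%:R * \tr (P *m H *m P *m H).
Proof.
move=> /posdef_cholesky[E ->] sH.
pose S := E *m H *m E^T.
have sS : S^T = S by rewrite /S !trmx_mul trmxK sH mulmxA.
have -> : \tr (E^T *m E *m H) = \tr S by rewrite -mulmxA mxtrace_mulC.
have -> : \tr (E^T *m E *m H *m (E^T *m E) *m H) = \tr (S *m S).
  by rewrite -!mulmxA mxtrace_mulC /S !mulmxA.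
rewrite mxtrace_prod//.
apply: (@le_trans _ _ (n%:R * \sum_i S i i ^+ 2)); last first.
  rewrite ler_wpM2l// ler_sum// => i _; rewrite (bigD1 i)//= -expr2 lerDl.
  by apply: sumr_ge0 => j _; rewrite -expr2 sqr_ge0.
have sq : 0 <= \sum_i \sum_j (S i i - S j j) ^+ 2.
  by apply: sumr_ge0 => i _; apply: sumr_ge0 => j _; exact: sqr_ge0.
have E1 : \sum_i \sum_j (S i i - S j j) ^+ 2 =
    (n%:R * \sum_i S i i ^+ 2) *+ 2 - (\tr S ^+ 2) *+ 2.
  pose q := \sum_i S i i ^+ 2.
  have inner i : \sum_j (S i i - S j j) ^+ 2 =
      n%:R * S i i ^+ 2 - S i i * \tr S *+ 2 + q.
    under eq_bigr do rewrite sqrrB.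
    rewrite big_split sumrB /= sumr_const card_ord; congr (_ - _ + _).
      by rewrite mulr_natl.
    by rewrite sumrMnl -mulr_sumr.
  under eq_bigr do rewrite inner.
  rewrite big_split sumrB /= sumr_const card_ord sumrMnl -mulr_suml -mulr_sumr.
  by rewrite -/q -[\sum_(i < n) S i i]/(\tr S) -[q *+ n]mulr_natl; ring.
by rewrite E1 subr_ge0 lerMn2r in sq.
Qed.
End PosDef.

(** * Curvature and Bochner's formula in a chart *)

Section MatrixCalculus.
Context {R : realType} {n : nat} {U : set 'rV[R]_n} (oU : open U).

(** Tensor fields are treated as matrix fields, so that the tensor identities below become
    noncommutative matrix algebra instead of manipulations of indexed sums. *)
Definition smooth_mx p q (X : 'rV[R]_n -> 'M[R]_(p, q)) : Prop :=
  forall a b, smooth_on U (fun x => X x a b).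

Definition partial_mx p q (i : 'I_n) (X : 'rV[R]_n -> 'M[R]_(p, q))
  (x : 'rV[R]_n) : 'M[R]_(p, q) := \matrix_(a, b) partial i (fun y => X y a b) x.

(** Unlike [mxE], this leaves the entries of matrix products folded, so that [ring] and [lra] see
    them as atoms. *)
Lemma addmxE p q (A B : 'M[R]_(p, q)) a b : (A + B) a b = A a b + B a b.
Proof. by rewrite mxE. Qed.

Lemma oppmxE p q (A : 'M[R]_(p, q)) a b : (- A) a b = - A a b.
Proof. by rewrite mxE. Qed.

Lemma smooth_on_ext (f g : 'rV[R]_n -> R) : (forall x, f x = g x) ->
  smooth_on U f -> smooth_on U g.
Proof. by move=> /funext ->. Qed.

Lemma smooth_mxD p q (X Y : 'rV[R]_n -> 'M[R]_(p, q)) :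
  smooth_mx X -> smooth_mx Y -> smooth_mx (fun x => X x + Y x).
Proof.
move=> sX sY a b; apply: smooth_on_ext (smooth_onD oU (sX a b) (sY a b)) => x.
by rewrite mxE.
Qed.

Lemma smooth_mxN p q (X : 'rV[R]_n -> 'M[R]_(p, q)) :
  smooth_mx X -> smooth_mx (fun x => - X x).
Proof.
move=> sX a b; apply: smooth_on_ext (smooth_onN oU (sX a b)) => x.
by rewrite mxE.
Qed.

Lemma smooth_mxM p q r (X : 'rV[R]_n -> 'M[R]_(p, q)) (Y : 'rV[R]_n -> 'M[R]_(q, r)) :
  smooth_mx X -> smooth_mx Y -> smooth_mx (fun x => X x *m Y x).
Proof.
move=> sX sY a b; apply: (@smooth_on_ext (fun x => \sum_k X x a k * Y x k b)).
  by move=> x; rewrite mxE.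
by apply: (smooth_on_sum oU) => k _; exact: (smooth_onM oU (sX a k) (sY k b)).
Qed.

Lemma smooth_mx_tr p q (X : 'rV[R]_n -> 'M[R]_(p, q)) :
  smooth_mx X -> smooth_mx (fun x => (X x)^T).
Proof. by move=> sX a b; apply: smooth_on_ext (sX b a) => x; rewrite mxE. Qed.

Lemma smooth_partial_mx p q (X : 'rV[R]_n -> 'M[R]_(p, q)) i :
  smooth_mx X -> smooth_mx (partial_mx i X).
Proof.
move=> sX a b; apply: smooth_on_ext (smooth_on_partial i (sX a b)) => x.
by rewrite mxE.
Qed.

Lemma smooth_trace p (X : 'rV[R]_n -> 'M[R]_p) :
  smooth_mx X -> smooth_on U (fun x => \tr (X x)).
Proof. by move=> sX; apply: (smooth_on_sum oU) => k _; exact: sX. Qed.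

Lemma smooth_det p (X : 'rV[R]_n -> 'M[R]_p) :
  smooth_mx X -> smooth_on U (fun x => \det (X x)).
Proof.
move=> sX; apply: (smooth_on_sum oU) => s _.
apply: (smooth_onM oU (smooth_on_cst oU _)).
by apply: (smooth_on_prod oU) => k _; exact: sX.
Qed.

(** By Cramer's rule the entries of the inverse are cofactors divided by the determinant. *)
Lemma smooth_invmx p (X : 'rV[R]_n -> 'M[R]_p) : smooth_mx X ->
  (forall x, U x -> X x \in unitmx) -> smooth_mx (fun x => invmx (X x)).
Proof.
move=> sX uX a b.
have det0 x : U x -> \det (X x) != 0 by move=> /uX; rewrite unitmxE unitfE.
have sadj : smooth_on U (fun x => \adj (X x) a b).
  apply: (@smooth_on_ext
    (fun x => (-1) ^+ (b + a) * \det (row' b (col' a (X x))))).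
    by move=> x; rewrite mxE.
  apply: (smooth_onM oU (smooth_on_cst oU _)).
  apply: smooth_det => i j; apply: smooth_on_ext (sX _ _) => x.
  by rewrite !mxE.
have := smooth_onM oU (smooth_onV oU det0 (smooth_det sX)) sadj.
apply: eq_on_smooth => // x Ux.
by rewrite /invmx uX// [RHS]mxE.
Qed.

Lemma eq_on_partial_mx p q (X Y : 'rV[R]_n -> 'M[R]_(p, q)) i x : U x ->
  (forall y, U y -> X y = Y y) -> partial_mx i X x = partial_mx i Y x.
Proof.
move=> Ux XY; apply/matrixP => a b; rewrite !mxE.
by apply: (eq_on_partial i oU Ux) => y /XY ->.
Qed.

Lemma partial_mxD p q (X Y : 'rV[R]_n -> 'M[R]_(p, q)) i x : U x ->
  smooth_mx X -> smooth_mx Y ->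
  partial_mx i (fun y => X y + Y y) x = partial_mx i X x + partial_mx i Y x.
Proof.
move=> Ux sX sY; apply/matrixP => a b; rewrite !mxE.
under [in LHS]eq_fun do rewrite mxE.
by rewrite partialD//; [exact: smooth_on_derivable (sX a b) Ux|
  exact: smooth_on_derivable (sY a b) Ux].
Qed.

Lemma partial_mxN p q (X : 'rV[R]_n -> 'M[R]_(p, q)) i x : U x ->
  smooth_mx X -> partial_mx i (fun y => - X y) x = - partial_mx i X x.
Proof.
move=> Ux sX; apply/matrixP => a b; rewrite !mxE.
under [in LHS]eq_fun do rewrite mxE.
by apply: deriveN; exact: smooth_on_derivable (sX a b) Ux.
Qed.

Lemma partial_mxM p q r (X : 'rV[R]_n -> 'M[R]_(p, q))
    (Y : 'rV[R]_n -> 'M[R]_(q, r)) i x : U x -> smooth_mx X -> smooth_mx Y ->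
  partial_mx i (fun y => X y *m Y y) x =
  partial_mx i X x *m Y x + X x *m partial_mx i Y x.
Proof.
move=> Ux sX sY; apply/matrixP => a b; rewrite !mxE.
under [in LHS]eq_fun do rewrite mxE.
rewrite (partial_sum oU _ i Ux) => [|k _]; last first.
  exact: (smooth_onM oU (sX a k) (sY k b)).
rewrite -big_split; apply: eq_bigr => k _ /=; rewrite !mxE.
by rewrite partialM//; [exact: smooth_on_derivable (sX a k) Ux|
  exact: smooth_on_derivable (sY k b) Ux].
Qed.

Lemma partial_mx_tr p q (X : 'rV[R]_n -> 'M[R]_(p, q)) i x :
  partial_mx i (fun y => (X y)^T) x = (partial_mx i X x)^T.
Proof.
by apply/matrixP => a b; rewrite !mxE; under [in LHS]eq_fun do rewrite mxE.
Qed.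

Lemma partial_trace p (X : 'rV[R]_n -> 'M[R]_p) i x : U x -> smooth_mx X ->
  partial i (fun y => \tr (X y)) x = \tr (partial_mx i X x).
Proof.
move=> Ux sX; rewrite (partial_sum oU _ i Ux) => [|k _]; last exact: sX.
by apply: eq_bigr => k _; rewrite mxE.
Qed.

Lemma partial_mxC p q (X : 'rV[R]_n -> 'M[R]_(p, q)) i j x : U x ->
  smooth_mx X ->
  partial_mx i (partial_mx j X) x = partial_mx j (partial_mx i X) x.
Proof.
move=> Ux sX; apply/matrixP => a b; rewrite [LHS]mxE [RHS]mxE.
have E k : (fun y => partial_mx k X y a b) = partial k (fun y => X y a b).
  by apply/funext => y; rewrite mxE.
by rewrite (E i) (E j); exact: (partialC oU i j (sX a b) Ux).
Qed.

End MatrixCalculus.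
Arguments smooth_mx {R n} U {p q} X.

Lemma trmxD {R : nmodType} p q (A B : 'M[R]_(p, q)) : (A + B)^T = A^T + B^T.
Proof. exact: raddfD. Qed.

Lemma trmxN {R : zmodType} p q (A : 'M[R]_(p, q)) : (- A)^T = - A^T.
Proof. exact: raddfN. Qed.

(** * Levi-Civita connection and curvature in matrix form *)

Section ChartGeometry.
Context {R : realType} {n : nat} {U : set 'rV[R]_n} (oU : open U).
Context {g : 'rV[R]_n -> 'M[R]_n} (sg : smooth_mx U g)
  (pg : forall x, U x -> posdef_mx (g x)).

(* With [A i := connection_mx g i], the metric satisfies                      *)
(* [d_i g = g *m A i + (A i)^T *m g], and the curvature is                    *)
(* [d_i (A j) - d_j (A i) + A i *m A j - A j *m A i].                         *)
Definition connection_mx (h : 'rV[R]_n -> 'M[R]_n) (i : 'I_n)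
    (x : 'rV[R]_n) : 'M[R]_n :=
  \matrix_(k, j) christoffel h k i j x.

Definition curvature_mx (h : 'rV[R]_n -> 'M[R]_n) (i j : 'I_n)
    (x : 'rV[R]_n) : 'M[R]_n :=
  \matrix_(l, k) riemann h l k i j x.

Definition gradient_row (f : 'rV[R]_n -> R) (x : 'rV[R]_n) : 'rV[R]_n :=
  \row_j partial j f x.

Let A := connection_mx g.
Let G (x : 'rV[R]_n) : 'M[R]_n := invmx (g x).
Let O := curvature_mx g.

Let uG x : U x -> g x \in unitmx.
Proof. by move=> Ux; exact: posdef_unitmx (pg Ux). Qed.

Let symg x : U x -> (g x)^T = g x.
Proof. by move=> Ux; have [] := pg Ux. Qed.

Let symG x : U x -> (G x)^T = G x.
Proof. by move=> Ux; have [] := posdef_invmx (pg Ux). Qed.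

Let sG : smooth_mx U G.
Proof. exact (smooth_invmx oU sg uG). Qed.

(** The Christoffel symbols of the first kind, with the lowered index as row. *)
Let low (i : 'I_n) x : 'M[R]_n :=
  \matrix_(l, j) (2^-1 * (partial i (fun y => g y j l) x
    + partial j (fun y => g y i l) x - partial l (fun y => g y i j) x)).

Let connectionE i x : A i x = G x *m low i x.
Proof.
apply/matrixP => k j; rewrite [LHS]mxE [RHS]mxE /christoffel mulr_sumr.
by apply: eq_bigr => l _; rewrite mxE mulrCA.
Qed.

Lemma smooth_connection i : smooth_mx U (A i).
Proof.
have sl : smooth_mx U (low i).
  move=> l j; apply: (@smooth_on_ext _ _ _ (fun x =>
    2^-1 * (partial i (fun y => g y j l) x + partial j (fun y => g y i l) x - partial l (fun y => g y i j) x))).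
    by move=> x; rewrite mxE.
  apply: (smooth_onM oU (smooth_on_cst oU _)); apply: (smooth_onB oU).
    apply: (smooth_onD oU); exact: smooth_on_partial (sg _ _).
  exact: smooth_on_partial (sg _ _).
move=> a b; apply: smooth_on_ext (smooth_mxM oU sG sl a b) => x.
by rewrite connectionE.
Qed.

Let partial_gC i x a b : U x ->
  partial i (fun y => g y a b) x = partial i (fun y => g y b a) x.
Proof.
move=> Ux; apply: (eq_on_partial i oU Ux) => y Uy.
by rewrite -[in LHS](symg Uy) mxE.
Qed.

Lemma christoffelC k i j x : U x ->
  christoffel g k i j x = christoffel g k j i x.
Proof.
move=> Ux; rewrite /christoffel; congr (_ * _); apply: eq_bigr => l _.
by rewrite (partial_gC l i j Ux) (addrC (partial i _ _)).
Qed.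

(** Metric compatibility: the two summands are [low i x] and its transpose, in whose sum two of the
    three derivatives cancel and the third doubles. *)
Lemma partial_metric i x : U x ->
  partial_mx i g x = g x *m A i x + (A i x)^T *m g x.
Proof.
move=> Ux; have gA : g x *m A i x = low i x.
  by rewrite connectionE mulmxA mulmxV ?mul1mx//; exact: uG.
have -> : (A i x)^T *m g x = (low i x)^T.
  by rewrite -gA trmx_mul symg.
rewrite gA; apply/matrixP => p l; rewrite !mxE.
rewrite (partial_gC i p l Ux) (partial_gC l i p Ux) (partial_gC p i l Ux).
rewrite (partial_gC l p i Ux) (partial_gC p l i Ux).
by rewrite (partial_gC i l p Ux); field.
Qed.

Lemma partial_metric_inv i x : U x ->
  partial_mx i G x = - (A i x *m G x) - G x *m (A i x)^T.
Proof.
move=> Ux.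
have : partial_mx i (fun y => g y *m G y) x = 0.
  rewrite (@eq_on_partial_mx _ _ _ oU _ _ _ (fun=> 1%:M) i x Ux).
    by apply/matrixP => a b; rewrite !mxE partial_cst.
  by move=> y Uy; rewrite mulmxV// uG.
rewrite (partial_mxM oU i Ux sg sG) partial_metric// => /eqP.
rewrite addrC addr_eq0 => /eqP E.
rewrite -[LHS](mulKmx (uG Ux)) E mulmxDl mulmxN mulmxDr opprD.
by rewrite -!mulmxA mulmxV ?uG// mulmx1 [X in - X - _]mulmxA mulVmx ?uG// mul1mx.
Qed.

Lemma curvatureE i j x : O i j x =
  partial_mx i (A j) x - partial_mx j (A i) x + A i x *m A j x - A j x *m A i x.
Proof.
apply/matrixP => l k; rewrite [LHS]mxE /riemann.
rewrite !addmxE !oppmxE.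
have E a b : partial a (christoffel g l b k) x = partial_mx a (A b) x l k.
  by rewrite [RHS]mxE; congr (partial _ _ _); apply/funext => y; rewrite [RHS]mxE.
rewrite !E sumrB addrA; congr (_ + _ - _); rewrite mxE; apply: eq_bigr => p _;
  by rewrite !mxE.
Qed.

(** Expressing the second derivatives of the metric by metric compatibility and exchanging their
    order leaves exactly this relation. *)
Lemma curvature_antisym i j x : U x -> g x *m O i j x = - ((O i j x)^T *m g x).
Proof.
move=> Ux.
have sA k := smooth_connection k.
have E a b : partial_mx a (partial_mx b g) x =
    (g x *m A a x + (A a x)^T *m g x) *m A b x + g x *m partial_mx a (A b) x
    + ((partial_mx a (A b) x)^T *m g x
       + (A b x)^T *m (g x *m A a x + (A a x)^T *m g x)).
  rewrite (@eq_on_partial_mx _ _ _ oU _ _ _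
    (fun y => g y *m A b y + (A b y)^T *m g y) a x Ux).
    2: by move=> y Uy; rewrite partial_metric.
  rewrite (partial_mxD a Ux (smooth_mxM oU sg (sA b))
    (smooth_mxM oU (smooth_mx_tr (sA b)) sg)).
  rewrite (partial_mxM oU a Ux sg (sA b)).
  rewrite (partial_mxM oU a Ux (smooth_mx_tr (sA b)) sg).
  by rewrite partial_mx_tr partial_metric.
have H := partial_mxC oU i j Ux sg; rewrite (E i j) (E j i) in H.
rewrite (curvatureE i j); move: H.
move: (partial_mx i (A j) x) (partial_mx j (A i) x) (A i x) (A j x) (g x).
move=> P Q a b c H; apply/matrixP => p q; move/matrixP/(_ p q): H.
(* Once everything is expanded into monomials, the goal is entrywise a linear consequence of [H]. *)
rewrite !(trmxD, trmxN, trmx_mul) !(mulmxDl, mulmxDr, mulmxN, mulNmx).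
rewrite !mulmxA !(addmxE, oppmxE).
lra.
Qed.
End ChartGeometry.

Definition nabla_hessian (R : realType) n (g : 'rV[R]_n -> 'M[R]_n)
    (w : 'rV[R]_n -> R) (m : 'I_n) (x : 'rV[R]_n) : 'M[R]_n :=
  partial_mx m (hessian g w) x - (connection_mx g m x)^T *m hessian g w x
  - hessian g w x *m connection_mx g m x.

(** * Bochner's formula *)

Section Bochner.
Context {R : realType} {n : nat} {U : set 'rV[R]_n} (oU : open U).
Context {g : 'rV[R]_n -> 'M[R]_n} (sg : smooth_mx U g)
  (pg : forall x, U x -> posdef_mx (g x)).

Let A := connection_mx g.
Let G (x : 'rV[R]_n) : 'M[R]_n := invmx (g x).
Let O := curvature_mx g.

Let uG x : U x -> g x \in unitmx.
Proof. by move=> Ux; exact: posdef_unitmx (pg Ux). Qed.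

Let symG x : U x -> (G x)^T = G x.
Proof. by move=> Ux; have [] := posdef_invmx (pg Ux). Qed.

Let sG : smooth_mx U G.
Proof. exact (smooth_invmx oU sg uG). Qed.

Let sA i : smooth_mx U (A i) := smooth_connection oU sg pg i.

(** The two sides pair the indices of [B] in opposite orders, which agree because the inverse metric
    is symmetric. *)
Lemma metric_traceE x (B : 'M[R]_n) : U x -> metric_trace g x B = \tr (G x *m B).
Proof.
move=> Ux; rewrite -[in RHS](symG Ux) mxtrace_mulC /mxtrace.
apply: eq_bigr => i _; rewrite mxE; apply: eq_bigr => j _.
by rewrite mxE mulrC.
Qed.

Section function.
Context {w : 'rV[R]_n -> R} (sw : smooth_on U w).

Let dw := gradient_row w.
Let H := hessian g w.

Lemma smooth_gradient_row : smooth_mx U dw.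
Proof.
move=> a b; apply: smooth_on_ext (smooth_on_partial b sw) => x.
by rewrite mxE.
Qed.

Lemma row_hessian m x : row m (H x) = partial_mx m dw x - dw x *m A m x.
Proof.
apply/rowP => l; rewrite !mxE; congr (_ - _).
  by congr (partial _ _ _); apply/funext => y; rewrite mxE.
by apply: eq_bigr => k _; rewrite !mxE mulrC.
Qed.

Lemma smooth_hessian : smooth_mx U H.
Proof.
move=> a b; have := smooth_mxD oU (smooth_partial_mx a smooth_gradient_row)
  (smooth_mxN oU (smooth_mxM oU smooth_gradient_row (sA a))).
move=> /(_ 0 b); apply: smooth_on_ext => x.
by rewrite -row_hessian mxE.
Qed.

Lemma hessian_sym x : U x -> (H x)^T = H x.
Proof.
move=> Ux; apply/matrixP => i j; rewrite !mxE.
rewrite (partialC oU i j sw Ux); congr (_ - _).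
by apply: eq_bigr => k _; rewrite (christoffelC oU pg k i j Ux).
Qed.

Lemma laplacianE x : U x -> laplacian g w x = \tr (G x *m H x).
Proof. exact: metric_traceE. Qed.

Lemma smooth_laplacian : smooth_on U (laplacian g w).
Proof.
have := smooth_trace oU (smooth_mxM oU sG smooth_hessian).
by apply: eq_on_smooth => // x Ux; rewrite laplacianE.
Qed.

Lemma grad_norm2E x : U x ->
  grad_norm2 g w x = (dw x *m G x *m (dw x)^T) 0 0.
Proof.
move=> Ux; rewrite /grad_norm2 metric_traceE//.
have -> : \matrix_(i, j) (partial i w x * partial j w x) = (dw x)^T *m dw x.
  by apply/matrixP => i j; rewrite !mxE big_ord1 !mxE.
by rewrite mulmxA mxtrace_mulC mulmxA [LHS]big_ord1.
Qed.

Lemma smooth_grad_norm2 : smooth_on U (grad_norm2 g w).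
Proof.
have := smooth_mxM oU (smooth_mxM oU smooth_gradient_row sG)
  (smooth_mx_tr smooth_gradient_row).
by move=> /(_ 0 0); apply: eq_on_smooth => // x Ux; rewrite grad_norm2E.
Qed.

Let mx11_tr (B : 'M[R]_1) : B^T = B.
Proof. by apply/matrixP => i j; rewrite !ord1 mxE. Qed.

(** The connection terms from differentiating [dw] cancel those from differentiating the inverse
    metric, so only the Hessian survives. *)
Lemma gradient_grad_norm2 x : U x ->
  gradient_row (grad_norm2 g w) x = 2 *: (dw x *m G x *m H x).
Proof.
move=> Ux; apply/rowP => l; rewrite [LHS]mxE [RHS]mxE.
have sdw := smooth_gradient_row.
have -> : partial l (grad_norm2 g w) x =
    (partial_mx l (fun y => dw y *m G y *m (dw y)^T) x) 0 0.
  rewrite mxE; apply: (eq_on_partial l oU Ux) => y Uy.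
  by rewrite grad_norm2E.
rewrite (partial_mxM oU l Ux (smooth_mxM oU sdw sG) (smooth_mx_tr sdw)).
rewrite (partial_mxM oU l Ux sdw sG) partial_mx_tr.
rewrite (partial_metric_inv oU sg pg l Ux).
have -> : (dw x *m G x *m H x) 0 l = (dw x *m G x *m (row l (H x))^T) 0 0.
  rewrite mxE [RHS]mxE; apply: eq_bigr => k _; rewrite -{1}(hessian_sym Ux).
  by rewrite !mxE.
have -> : partial_mx l dw x = row l (H x) + dw x *m A l x.
  by rewrite row_hessian subrK.
rewrite -/(A l x) -/(G x); have := symG Ux.
move: (row l (H x)) (dw x) (G x) (A l x) => h d P a sP.
rewrite trmxD trmx_mul !(mulmxDl, mulmxDr, mulmxN, mulNmx) !mulmxA.
have -> : h *m P *m d^T = d *m P *m h^T.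
  by rewrite -[LHS]mx11_tr !trmx_mul trmxK sP mulmxA.
rewrite !(addmxE, oppmxE); ring.
Qed.

Let Tm := nabla_hessian g w.

Lemma row_hessian_grad_norm2 m x : U x ->
  row m (hessian g (grad_norm2 g w) x) =
  2 *: (row m (H x) *m G x *m H x + dw x *m G x *m Tm m x).
Proof.
move=> Ux; have sdw := smooth_gradient_row; have sH := smooth_hessian.
pose Z y := dw y *m G y *m H y.
have sZ : smooth_mx U Z by exact: (smooth_mxM oU (smooth_mxM oU sdw sG) sH).
have dZ y : U y -> gradient_row (grad_norm2 g w) y = Z y + Z y.
  by move=> Uy; rewrite gradient_grad_norm2// scaler_nat mulr2n.
have -> : row m (hessian g (grad_norm2 g w) x) =
    partial_mx m (gradient_row (grad_norm2 g w)) x -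
    gradient_row (grad_norm2 g w) x *m A m x.
  apply/rowP => l; rewrite !mxE; congr (_ - _).
    by congr (partial _ _ _); apply/funext => y; rewrite mxE.
  by apply: eq_bigr => k _; rewrite !mxE mulrC.
rewrite (eq_on_partial_mx oU m Ux dZ) dZ// (partial_mxD m Ux sZ sZ).
rewrite (partial_mxM oU m Ux (smooth_mxM oU sdw sG) sH).
rewrite (partial_mxM oU m Ux sdw sG) (partial_metric_inv oU sg pg m Ux).
have -> : partial_mx m dw x = row m (H x) + dw x *m A m x.
  by rewrite row_hessian subrK.
rewrite /Z /Tm /nabla_hessian -/H -/A scaler_nat mulr2n -/(A m x) -/(G x).
move: (row m (H x)) (dw x) (G x) (A m x) (partial_mx m H x) (H x).
move=> h d P a dH X; apply/matrixP => p q.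
rewrite !(mulmxDl, mulmxDr, mulmxN, mulNmx) !mulmxA !(addmxE, oppmxE); ring.
Qed.

(** The Ricci commutation identity for the one-form [dw]. The correction terms in the index [q]
    match by symmetry of the Christoffel symbols ([Esym]), and the second partial derivatives of
    [dw] commute. *)
Lemma codazzi m q l x : U x -> Tm m x q l - Tm q x m l = - (dw x *m O m q x) 0 l.
Proof.
move=> Ux; have sdw := smooth_gradient_row; have sH := smooth_hessian.
have Esym : ((A m x)^T *m H x) q l = ((A q x)^T *m H x) m l.
  rewrite mxE [RHS]mxE; apply: eq_bigr => k _; rewrite !mxE.
  by rewrite (christoffelC oU pg k m q Ux).
have dH a b : partial_mx a H x b l =
    (partial_mx a (partial_mx b dw) x - partial_mx a dw x *m A b x
     - dw x *m partial_mx a (A b) x) 0 l.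
  transitivity (partial_mx a (fun y => row b (H y)) x 0 l).
    rewrite [LHS]mxE [RHS]mxE; congr (partial _ _ _).
    by apply/funext => y; rewrite [RHS]mxE.
  have := eq_on_partial_mx oU a Ux (fun y _ => row_hessian b y) => ->.
  rewrite (partial_mxD a Ux (smooth_partial_mx b sdw)
    (smooth_mxN oU (smooth_mxM oU sdw (sA b)))).
  rewrite (partial_mxN a Ux (smooth_mxM oU sdw (sA b))).
  by rewrite (partial_mxM oU a Ux sdw (sA b)) opprD addrA.
have HA a b : (H x *m A a x) b l =
    ((partial_mx b dw x - dw x *m A b x) *m A a x) 0 l.
  by rewrite -row_hessian -row_mul [RHS]mxE.
have TmE a b : Tm a x b l = (partial_mx a (partial_mx b dw) x
     - partial_mx a dw x *m A b x - dw x *m partial_mx a (A b) x) 0 l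
     - ((A a x)^T *m H x) b l
     - ((partial_mx b dw x - dw x *m A b x) *m A a x) 0 l.
  rewrite -(dH a b) -(HA a b) /Tm /nabla_hessian -/H -/A [LHS]mxE.
  by rewrite [X in X + _]mxE !oppmxE.
apply: (etrans (congr2 (fun a b => a - b) (TmE m q) (TmE q m))).
rewrite Esym (partial_mxC oU m q Ux sdw).
have -> : O m q x = partial_mx m (A q) x - partial_mx q (A m) x
  + A m x *m A q x - A q x *m A m x := curvatureE m q x.
move: (((A q x)^T *m H x) m l) => X0.
move: (partial_mx q (partial_mx m dw) x) (partial_mx m dw x) (partial_mx q dw x).
move: (dw x) (partial_mx m (A q) x) (partial_mx q (A m) x) (A m x) (A q x).
move=> d P Q a b X y z.
rewrite !(mulmxDl, mulmxDr, mulmxN, mulNmx) !mulmxA !(addmxE, oppmxE); ring.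
Qed.

Lemma partial_laplacian q x : U x ->
  partial q (laplacian g w) x = \tr (G x *m Tm q x).
Proof.
move=> Ux; have sH := smooth_hessian.
rewrite (eq_on_partial q oU Ux laplacianE).
rewrite (partial_trace oU q Ux (smooth_mxM oU sG sH)).
rewrite (partial_mxM oU q Ux sG sH) (partial_metric_inv oU sg pg q Ux).
rewrite /Tm /nabla_hessian -/H -/A -/(G x).
move: (G x) (A q x) (partial_mx q H x) (H x) => P a dH X.
rewrite !(mulmxDl, mulmxDr, mulmxN, mulNmx) !raddfD !raddfN /=.
rewrite -[a *m P *m X]mulmxA [\tr (a *m _)]mxtrace_mulC !mulmxA.
ring.
Qed.

(** Here [dw] takes the upper index of the curvature and the metric contracts the lower index [l]
    with [m], whereas [ricci] contracts the upper index with [m]. Antisymmetry, in the form [OG],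
    exchanges the two at the price of a sign. *)
Lemma ricci_contraction q x : U x ->
  \sum_m \sum_l G x m l * (dw x *m O m q x) 0 l =
  - \sum_p (dw x *m G x) 0 p * ricci g x q p.
Proof.
move=> Ux.
have OG m : O m q x *m G x = - (G x *m (O m q x)^T).
  rewrite -[LHS](mulKmx (uG Ux)) !mulmxA -/(G x).
  rewrite -[G x *m g x *m _]mulmxA (curvature_antisym oU sg pg m q Ux).
  by rewrite mulmxN mulNmx -!mulmxA mulmxV ?uG// mulmx1.
transitivity (\sum_m (dw x *m O m q x *m G x) 0 m).
  apply: eq_bigr => m _; rewrite [RHS]mxE; apply: eq_bigr => l _.
  by rewrite [LHS]mulrC; congr (_ * _); have /matrixP/(_ m l) := symG Ux; rewrite mxE.
transitivity (- \sum_m \sum_p (dw x *m G x) 0 p * O m q x m p).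
  rewrite -sumrN; apply: eq_bigr => m _.
  rewrite -mulmxA OG mulmxN mulmxA oppmxE [in LHS]mxE; congr (- _).
  by apply: eq_bigr => p _; rewrite [_^T _ _]mxE.
rewrite exchange_big; congr (- _); apply: eq_bigr => p _ /=.
rewrite -mulr_sumr; congr (_ * _); rewrite mxE.
by apply: eq_bigr => m _; rewrite mxE.
Qed.

(** Tracing [row_hessian_grad_norm2] differentiates the Hessian in a contracted index. [codazzi]
    moves that derivative to the direction of the gradient, where the trace becomes the derivative
    of the Laplacian, and the commutator contributes the Ricci term. *)
Lemma bochner x : U x ->
  laplacian g (grad_norm2 g w) x =
  2 * \tr (G x *m H x *m G x *m H x)
  + 2 * \sum_q (dw x *m G x) 0 q * partial q (laplacian g w) x
  + 2 * (dw x *m G x *m ricci g x *m (dw x *m G x)^T) 0 0.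
Proof.
move=> Ux; set u := dw x *m G x.
have hE m l : hessian g (grad_norm2 g w) x m l =
    2 * ((H x *m G x *m H x) m l + \sum_q u 0 q * Tm m x q l).
  have /rowP/(_ l) := row_hessian_grad_norm2 m Ux.
  rewrite [LHS]mxE => ->; rewrite [LHS]mxE addmxE -!row_mul [row _ _ _ _]mxE.
  by rewrite [(u *m _) _ _]mxE.
have -> : laplacian g (grad_norm2 g w) x =
    2 * (\sum_m \sum_l G x m l * (H x *m G x *m H x) m l) +
    2 * (\sum_m \sum_l G x m l * \sum_q u 0 q * Tm m x q l).
  rewrite -mulrDr -big_split mulr_sumr; apply: eq_bigr => m _ /=.
  rewrite -big_split mulr_sumr; apply: eq_bigr => l _ /=.
  by rewrite hE -mulrDr [LHS]mulrCA.
rewrite -addrA; congr (2 * _ + _).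
  by rewrite -!mulmxA -metric_traceE// !mulmxA.
rewrite -mulrDr; congr (_ * _).
transitivity (\sum_q u 0 q * \sum_m \sum_l G x m l * Tm m x q l).
  under eq_bigr do under eq_bigr do rewrite mulr_sumr.
  under eq_bigr do rewrite exchange_big.
  rewrite exchange_big; apply: eq_bigr => q _ /=.
  rewrite mulr_sumr; apply: eq_bigr => m _; rewrite mulr_sumr.
  by apply: eq_bigr => l _; rewrite mulrCA.
rewrite -[u *m _ *m _]mulmxA [X in _ + X]mxE -big_split.
apply: eq_bigr => q _ /=; rewrite -mulrDr; congr (_ * _).
have Tswap m l : Tm m x q l = Tm q x m l - (dw x *m O m q x) 0 l.
  by apply/eqP; rewrite -(codazzi m q l Ux) addrC subrK.
under eq_bigr do under eq_bigr do rewrite Tswap mulrBr.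
under eq_bigr do rewrite sumrB.
rewrite sumrB ricci_contraction// opprK (partial_laplacian q Ux).
congr (_ + _); first by rewrite -metric_traceE.
by rewrite mxE; apply: eq_bigr => p _; rewrite [u^T _ _]mxE mulrC.
Qed.
End function.
End Bochner.

(** * Chain rules and the maximum principle for the Laplacian *)

Section ChainRule.
Context {R : realType} {n : nat} {U : set 'rV[R]_n} (oU : open U).
Context {g : 'rV[R]_n -> 'M[R]_n} (sg : smooth_mx U g)
  (pg : forall x, U x -> posdef_mx (g x)).
Context {w : 'rV[R]_n -> R} (sw : smooth_on U w).

Lemma grad_norm2_trace (f : 'rV[R]_n -> R) x : U x ->
  grad_norm2 g f x = \tr (invmx (g x) *m ((gradient_row f x)^T *m gradient_row f x)).
Proof.
move=> Ux; rewrite /grad_norm2 (metric_traceE pg)//; congr (\tr (_ *m _)).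
by apply/matrixP => i j; rewrite !mxE big_ord1 !mxE.
Qed.

Lemma grad_norm2_ge0 (f : 'rV[R]_n -> R) x : U x -> 0 <= grad_norm2 g f x.
Proof.
move=> Ux; rewrite (grad_norm2E pg)//.
have [->|df] := eqVneq (gradient_row f x) 0; first by rewrite !mul0mx mxE.
by apply: ltW; exact: (posdef_invmx (pg Ux)).2.
Qed.

(** Here [a] and [b] stand for the first and second derivatives of [phi] as a function of [w].
    Stating only their effect on differentials covers both polynomials in [w] and the logarithm. *)
Lemma laplacian_chain (phi a : 'rV[R]_n -> R) (b : R) x : U x ->
  smooth_on U a ->
  (forall j y, U y -> partial j phi y = a y * partial j w y) ->
  (forall i, partial i a x = b * partial i w x) ->
  laplacian g phi x = a x * laplacian g w x + b * grad_norm2 g w x.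
Proof.
move=> Ux sa dphi da.
have E : hessian g phi x = a x *: hessian g w x +
    b *: ((gradient_row w x)^T *m gradient_row w x).
  apply/matrixP => i j; rewrite !mxE big_ord1 !mxE.
  rewrite (eq_on_partial i oU Ux (dphi j)) partialM ?da.
  - rewrite mulrBr mulr_sumr -mulrA addrC addrAC -!addrA; congr (_ + _).
    rewrite addrC; congr (_ + _); congr (- _); apply: eq_bigr => k _.
    by rewrite dphi// mulrCA.
  - exact: smooth_on_derivable sa Ux.
  - exact: smooth_on_derivable (smooth_on_partial j sw) Ux.
rewrite /laplacian !(metric_traceE pg)// E mulmxDr -!scalemxAr.
by rewrite mxtraceD !mxtraceZ -grad_norm2_trace.
Qed.

Lemma grad_norm2_chain (phi : 'rV[R]_n -> R) (a : R) x : U x ->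
  (forall j, partial j phi x = a * partial j w x) ->
  grad_norm2 g phi x = a ^+ 2 * grad_norm2 g w x.
Proof.
move=> Ux dphi; rewrite !grad_norm2_trace//.
have -> : gradient_row phi x = a *: gradient_row w x.
  by apply/rowP => j; rewrite !mxE.
have -> : (a *: gradient_row w x)^T = a *: (gradient_row w x)^T.
  by apply/matrixP => i j; rewrite !mxE.
by rewrite -!scalemxAl -!scalemxAr !mxtraceZ expr2 mulrA.
Qed.

Lemma laplacian_horner (p : {poly R}) x : U x ->
  laplacian g (fun y => p.[w y]) x =
  p^`().[w x] * laplacian g w x + p^`()^`().[w x] * grad_norm2 g w x.
Proof.
move=> Ux; apply: (laplacian_chain Ux (smooth_on_horner oU p^`() sw)).
  by move=> j y Uy; rewrite (partial_horner oU p j sw Uy).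
by move=> i; rewrite (partial_horner oU p^`() i sw Ux).
Qed.

Lemma laplacianD (f h : 'rV[R]_n -> R) x : U x ->
  smooth_on U f -> smooth_on U h ->
  laplacian g (fun y => f y + h y) x = laplacian g f x + laplacian g h x.
Proof.
move=> Ux sf sh.
have D j y : U y -> partial j (fun y => f y + h y) y = partial j f y + partial j h y.
  move=> Uy; apply: partialD; first exact: smooth_on_derivable sf Uy.
  exact: smooth_on_derivable sh Uy.
have E : hessian g (fun y => f y + h y) x = hessian g f x + hessian g h x.
  apply/matrixP => i j; rewrite !mxE (eq_on_partial i oU Ux (D j)) partialD.
  - under eq_bigr do rewrite D// mulrDr.
    by rewrite big_split opprD addrACA.
  - exact: smooth_on_derivable (smooth_on_partial j sf) Ux.
  - exact: smooth_on_derivable (smooth_on_partial j sh) Ux.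
by rewrite /laplacian !(metric_traceE pg)// E mulmxDr mxtraceD.
Qed.

(** At a critical point the Christoffel terms of the Hessian vanish, leaving the matrix of second
    partial derivatives, which is negative semidefinite at a maximum. *)
Lemma laplacian_local_max (f : 'rV[R]_n -> R) x : smooth_on U f -> U x ->
  (forall y, U y -> f y <= f x) -> laplacian g f x <= 0.
Proof.
move=> sf Ux fmax; rewrite /laplacian (metric_traceE pg)//.
apply: posdef_trace_le0; first exact: posdef_invmx (pg Ux).
move=> v; have := local_max_second_derivative oU v sf Ux fmax.
congr (_ <= 0); rewrite -mulmxA mxE; apply: eq_bigr => i _.
rewrite mxE mulr_sumr; apply: eq_bigr => j _; rewrite !mxE.
rewrite big1 ?subr0 => [|k _]; first by rewrite -mulrA [_ * v 0 j]mulrC.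
by rewrite (local_max_partial oU k sf Ux fmax) mulr0.
Qed.

Lemma partial_ln i x : U x -> 0 < w x ->
  partial i (fun y => ln (w y)) x = (w x)^-1 * partial i w x.
Proof.
move=> Ux w0; have [dw _] := smooth_on_differentiable oU sw Ux.
have dl : is_derive (w x) (1 : R) (@ln R) (w x)^-1 := is_derive1_ln w0.
have dl' : differentiable (@ln R) (w x).
  by apply/derivable1_diffP; exact: (@ex_derive _ _ _ _ _ _ _ dl).
transitivity ('d (@ln R \o w) x (delta_mx 0 i)).
  exact: deriveE (differentiable_comp dw dl').
rewrite diff_comp//= diff1E// -deriveE// derive1E (@derive_val _ _ _ _ _ _ _ dl).
exact: mulrC.
Qed.
End ChainRule.

(** * Quasi-Einstein metrics in a chart *)

Section QuasiEinsteinChart.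
Context {R : realType} {n : nat} {U : set 'rV[R]_n} (oU : open U).
Context {g : 'rV[R]_n -> 'M[R]_n} (sg : smooth_mx U g)
  (pg : forall x, U x -> posdef_mx (g x)).
Context {w : 'rV[R]_n -> R} (sw : smooth_on U w) (w0 : forall x, U x -> 0 < w x).
Context {k c : R}.
Hypothesis qe : forall x, U x ->
  ricci g x - (k * (w x)^-1) *: hessian g w x = c *: g x.

Let F := grad_norm2 g w.
Let D := laplacian g w.

Let ricciE x : U x -> ricci g x = c *: g x + (k * (w x)^-1) *: hessian g w x.
Proof. by move=> /qe <-; rewrite subrK. Qed.

Lemma trace_ricci x : U x ->
  metric_trace g x (ricci g x) = n%:R * c + k * (w x)^-1 * D x.
Proof.
move=> Ux; rewrite /D /laplacian !(metric_traceE pg)// ricciE// mulmxDr.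
rewrite -!scalemxAr mxtraceD !mxtraceZ mulVmx ?mxtrace1; last first.
  exact: posdef_unitmx (pg Ux).
by rewrite [c * _]mulrC.
Qed.

Section characteristic.
Context {d : R} (k0 : k != 0).
Let phi x := - ln (w x `^ k).
Hypothesis ch : forall x, U x ->
  metric_trace g x (ricci g x) + 2 * laplacian g phi x
  - (k + 1) / k * grad_norm2 g phi x + k * d * (w x) ^- 2 = (k + n%:R) * c.

(** With [phi = - k ln w], the characteristic equation involves only the Laplacian and gradient of
    [w]; multiplying by [w ^+ 2] and cancelling [k] gives the identity. *)
Lemma density_laplacian x : U x ->
  w x * D x = d - c * w x ^+ 2 + (1 - k) * F x.
Proof.
move=> Ux.
have wn0 y : U y -> w y != 0 by move=> /w0 /lt0r_neq0.
pose a y := - k * (w y)^-1.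
have sa : smooth_on U a.
  exact: (smooth_onM oU (smooth_on_cst oU _) (smooth_onV oU wn0 sw)).
have phiE : phi = (fun y => - k * ln (w y)).
  by apply/funext => y; rewrite /phi ln_powR mulNr.
have dln j y : U y -> derivable (fun y => ln (w y)) y (delta_mx 0 j).
  move=> Uy; apply: diff_derivable.
  have [dw _] := smooth_on_differentiable oU sw Uy.
  apply: (differentiable_comp dw); apply/derivable1_diffP.
  exact: (@ex_derive _ _ _ _ _ _ _ (is_derive1_ln (w0 Uy))).
have dphi j y : U y -> partial j phi y = a y * partial j w y.
  move=> Uy; rewrite phiE partialM ?partial_cst ?mul0r ?add0r.
  - by rewrite (partial_ln oU sw j Uy (w0 Uy)) /a mulrA.
  - exact: derivable_cst.
  - exact: dln.
have da i : partial i a x = (k * (w x)^-2) * partial i w x.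
  rewrite /a partialM ?partial_cst ?mul0r ?add0r.
  - rewrite partialV ?wn0//; last exact: smooth_on_derivable sw Ux.
    by rewrite mulrNN !mulrA expr2 invfM mulrA.
  - exact: derivable_cst.
  - exact: smooth_on_derivable (smooth_onV oU wn0 sw) Ux.
have := ch Ux; rewrite trace_ricci//.
rewrite (laplacian_chain oU pg sw Ux sa dphi da).
rewrite (grad_norm2_chain pg Ux (fun j => dphi j x Ux)) -/(D x) -/(F x) /a.
move: (w0 Ux) => wx0 E.
have wx : w x != 0 by rewrite gt_eqF.
have : k * (w x * D x) = k * (d - c * w x ^+ 2 + (1 - k) * F x).
  move: E; move: (D x) (F x) (w x) wx => DD FF W wx E.
  have : ((k + n%:R) * c - (n%:R * c + k * W^-1 * DD
    + 2 * (- k * W^-1 * DD + k * W ^- 2 * FF) -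
    (k + 1) / k * ((- k * W^-1) ^+ 2 * FF) + k * d * W ^- 2)) * W ^+ 2 = 0.
    by rewrite E subrr mul0r.
  have -> : ((k + n%:R) * c - (n%:R * c + k * W^-1 * DD
    + 2 * (- k * W^-1 * DD + k * W ^- 2 * FF) -
    (k + 1) / k * ((- k * W^-1) ^+ 2 * FF) + k * d * W ^- 2)) * W ^+ 2 =
    k * (W * DD) - k * (d - c * W ^+ 2 + (1 - k) * FF).
    by field; rewrite wx k0.
  by move/eqP; rewrite subr_eq0 => /eqP.
by move/(mulfI k0).
Qed.

Lemma trace_ricci_grad x : U x ->
  metric_trace g x (ricci g x) =
  (n%:R - k) * c + k * d / w x ^+ 2 - k * (k - 1) * F x / w x ^+ 2.
Proof.
move=> Ux; have wx : w x != 0 by rewrite gt_eqF// w0.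
rewrite trace_ricci//.
have -> : D x = (d - c * w x ^+ 2 + (1 - k) * F x) / w x.
  by rewrite -density_laplacian// mulrAC mulfV// mul1r.
by field.
Qed.

(** The Laplacian of [F + p(w)] is nonpositive at its maximum. Criticality and the quasi-Einstein
    equation evaluate every term of Bochner's formula except the squared norm of the Hessian, which
    is bounded below by its trace. *)
Lemma max_inequality (p : {poly R}) x : (0 < n)%N -> U x ->
  (forall y, U y -> F y + p.[w y] <= F x + p.[w x]) ->
  2 / n%:R * D x ^+ 2 - 2 * D x * F x / w x - 2 * c * F x
  + (k - 2) * p^`().[w x] * F x / w x
  + p^`().[w x] * D x + p^`()^`().[w x] * F x <= 0.
Proof.
move=> n0 Ux Ymax; have wx : w x != 0 by rewrite gt_eqF// w0.
have sF : smooth_on U F by exact: smooth_grad_norm2.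
have sD : smooth_on U D by exact: smooth_laplacian.
have sp := smooth_on_horner oU p sw.
have sY := smooth_onD oU sF sp.
have dF q : partial q F x = - p^`().[w x] * partial q w x.
  have := local_max_partial oU q sY Ux Ymax.
  rewrite partialD; last 2 first.
  - exact: smooth_on_derivable sF Ux.
  - exact: smooth_on_derivable sp Ux.
  by rewrite (partial_horner oU p q sw Ux) => /eqP; rewrite addr_eq0 -mulNr => /eqP.
have LY := laplacian_local_max oU pg sY Ux Ymax.
rewrite (laplacianD oU pg Ux sF sp) (laplacian_horner oU pg sw p Ux) in LY.
rewrite (bochner oU sg pg sw Ux) -/(D x) -/(F x) in LY.
set u := gradient_row w x *m invmx (g x) in LY.
have uF : (u *m (gradient_row w x)^T) 0 0 = F x.
  by rewrite /F (grad_norm2E pg).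
have uFs : \sum_q u 0 q * partial q w x = F x.
  by rewrite -uF mxE; apply: eq_bigr => q _; rewrite !mxE.
have guT : g x *m u^T = (gradient_row w x)^T.
  have [sI _] := posdef_invmx (pg Ux).
  by rewrite /u trmx_mul sI mulKVmx//; exact: posdef_unitmx (pg Ux).
(* The differential of [F] is twice the Hessian applied to the gradient of [w]; criticality equates
   it with [- p'(w) dw]. *)
have uHu : (u *m hessian g w x *m u^T) 0 0 = - (p^`().[w x] / 2) * F x.
  have E : 2 *: (u *m hessian g w x) = - p^`().[w x] *: gradient_row w x.
    rewrite -(gradient_grad_norm2 oU sg pg sw Ux).
    by apply/rowP => q; rewrite !mxE; exact: dF.
  have -> : u *m hessian g w x = - (p^`().[w x] / 2) *: gradient_row w x.
    apply: (@scalerI _ _ (2 : R)); first by rewrite pnatr_eq0.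
    by rewrite E scalerA; congr (_ *: _); field.
  rewrite -scalemxAl mxE; congr (_ * _).
  by rewrite -[_ *m _]trmxK trmx_mul trmxK mxE.
have uRu : (u *m ricci g x *m u^T) 0 0 =
    c * F x - k * (w x)^-1 * (p^`().[w x] / 2) * F x.
  rewrite ricciE// mulmxDr mulmxDl addmxE -!scalemxAr -!scalemxAl.
  rewrite -[u *m g x *m _]mulmxA guT [X in X + _]mxE uF [X in _ + X]mxE uHu.
  by rewrite mulNr mulrN !mulrA.
(* Obtained by differentiating [density_laplacian] and inserting [dF], so that no third derivative
   of [w] remains. *)
have wD q : w x * partial q D x = - D x * partial q w x
    - 2 * c * w x * partial q w x - (1 - k) * p^`().[w x] * partial q w x.
  pose P := d%:P - c *: 'X^2 : {poly R}.
  have PE (t : R) : P.[t] = d - c * t ^+ 2 by rewrite /P !hornerE.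
  have dPE (t : R) : P^`().[t] = - (2 * c * t).
    rewrite /P derivB derivC derivZ derivXn sub0r !hornerE /=; ring.
  have E y : U y -> w y * D y = P.[w y] + (1 - k) * F y.
    by move=> Uy; rewrite density_laplacian// PE.
  have := eq_on_partial q oU Ux E.
  rewrite partialM; last 2 first.
  - exact: smooth_on_derivable sw Ux.
  - exact: smooth_on_derivable sD Ux.
  rewrite partialD; last 2 first.
  - exact: smooth_on_derivable (smooth_on_horner oU P sw) Ux.
  - exact: smooth_on_derivable (smooth_onM oU (smooth_on_cst oU _) sF) Ux.
  rewrite (partial_horner oU P q sw Ux) dPE partialM; last 2 first.
  - exact: derivable_cst.
  - exact: smooth_on_derivable sF Ux.
  by rewrite partial_cst dF => H; lra.
have uD : w x * \sum_q u 0 q * partial q D x =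
    (- D x - 2 * c * w x - (1 - k) * p^`().[w x]) * F x.
  rewrite -uFs !mulr_sumr; apply: eq_bigr => q _.
  by rewrite mulrCA wD; ring.
have tH : D x ^+ 2 / n%:R <=
    \tr (invmx (g x) *m hessian g w x *m invmx (g x) *m hessian g w x).
  rewrite ler_pdivrMr ?ltr0n// mulrC /D (laplacianE pg)//.
  exact: posdef_trace_sqr (posdef_invmx (pg Ux)) (hessian_sym oU pg sw Ux).
rewrite uRu -/D in LY; move: LY tH uD.
move: (\tr _) (\sum_q _) => T S LY tH uD.
have SE : S = (- D x - 2 * c * w x - (1 - k) * p^`().[w x]) * F x / w x.
  by rewrite -uD mulrAC mulfV// mul1r.
apply: le_trans LY; rewrite -subr_ge0 SE.
have nn : n%:R != 0 :> R by rewrite pnatr_eq0 -lt0n.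
move: (F x) (D x) (w x) wx (p^`().[w x]) (p^`()^`().[w x]) tH.
move=> FF DD W Wn0 p1 p2 tH.
rewrite [X in 0 <= X](_ : _ = 2 * (T - DD ^+ 2 / n%:R)); first by lra.
by field; rewrite nn Wn0.
Qed.
End characteristic.
End QuasiEinsteinChart.

(* Put [X := W * D] and [y := F + lambda / N - mu / (m - 1) * W ^+ 2], where   *)
(* [N := m + n%:R - 1]. Once [T] is eliminated, [W ^+ 2] times the left-hand   *)
(* side of the last hypothesis equals                                          *)
(* [2 * (m - 1) / n%:R * X * y                                                 *)
(*  + s%:R * e * W ^+ s.+2 * (lambda - mu * W ^+ 2 + s.+2%:R * F)].            *)
(* Its last factor is at least [X], and [X] is positive because                *)
(* [X = N * y + n%:R * (mu / (m - 1)) * W ^+ 2].                               *)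
Lemma barrier_contradiction (R : realFieldType) (n s : nat)
    (m mu lambda W F D T e a : R) :
  (0 < n)%N -> 1 < m -> 0 < mu -> 0 < W -> 0 <= F -> 0 < e -> 0 < a ->
  m + n%:R - 3 <= s%:R -> 2 * (m - 1) / n%:R <= s%:R ->
  W * D = lambda - mu * W ^+ 2 + (m + n%:R - 1) * F ->
  F + lambda / (m + n%:R - 1) + e * W ^+ s.+2 = T * W ^+ 2 ->
  mu / (m - 1) + e * a <= T ->
  (m + n%:R - 1) * e * W ^+ s < n%:R * (mu / (m - 1)) ->
  2 / n%:R * D ^+ 2 - 2 * D * F / W - 2 * mu * F
  + (- (m + n%:R)) * (s.+2%:R * e * W ^+ s.+1 - 2 * T * W) * F / W
  + (s.+2%:R * e * W ^+ s.+1 - 2 * T * W) * D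
  + (s.+2%:R * s.+1%:R * e * W ^+ s - 2 * T) * F <= 0 -> False.
Proof.
move=> n0 m1 mu0 W0 F0 e0 a0 sN sk DE TE aT eW.
apply/negP; rewrite -ltNge.
have n0' : 0 < n%:R :> R by rewrite ltr0n.
have nge1 : 1 <= n%:R :> R by rewrite ler1n.
have N0 : 0 < m + n%:R - 1 by lra.
have Wn0 := lt0r_neq0 W0; have nn0 := lt0r_neq0 n0'; have Nn0 := lt0r_neq0 N0.
have m1n0 : m - 1 != 0 by rewrite subr_eq0 gt_eqF.
(* With the power of variable exponent abstracted, the final identity is rational in [W] and [A],
   within reach of [field]. *)
have [A AE] : exists A, W ^+ s = A by exists (W ^+ s).
have A0 : 0 < A by rewrite -AE exprn_gt0.
have AS : W ^+ s.+1 = W * A by rewrite exprS AE.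
have ASS : W ^+ s.+2 = W ^+ 2 * A by rewrite expr2 -mulrA -AS exprS.
rewrite ASS in TE; rewrite AE in eW; rewrite AS AE.
pose X := W * D.
pose y := F + lambda / (m + n%:R - 1) - mu / (m - 1) * W ^+ 2.
have yE : y = (T - mu / (m - 1)) * W ^+ 2 - e * A * W ^+ 2.
  by rewrite /y mulrBl -TE; ring.
have W2 : 0 < W ^+ 2 by rewrite exprn_gt0.
have y_ge : e * (a - A) * W ^+ 2 <= y.
  have : e * (a - A) <= T - mu / (m - 1) - e * A by rewrite mulrBr; lra.
  by rewrite yE -mulrBl; exact: (ler_wpM2r (ltW W2)).
have XE : X = (m + n%:R - 1) * y + n%:R * (mu / (m - 1)) * W ^+ 2.
  by rewrite /X DE /y; field; rewrite Nn0 m1n0.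
(* The number [y] may be negative, but not below [- e * A * W ^+ 2]; the smallness of [e] makes the
   second term of [XE] prevail. *)
have X0 : 0 < X.
  apply: (@lt_le_trans _ _ ((m + n%:R - 1) * (e * (a - A) * W ^+ 2) +
      n%:R * (mu / (m - 1)) * W ^+ 2)); last by rewrite XE lerD2r ler_pM2l.
  rewrite [ltRHS](_ : _ = ((n%:R * (mu / (m - 1)) - (m + n%:R - 1) * e * A)
      + (m + n%:R - 1) * e * a) * W ^+ 2); last by ring.
  by rewrite mulr_gt0// addr_gt0 ?subr_gt0// !mulr_gt0.
pose Q := lambda - mu * W ^+ 2 + (s%:R + 2) * F.
have XQ : X <= Q.
  by rewrite /X /Q DE lerD2l ler_wpM2r//; lra.
have s0 : 0 <= s%:R :> R by rewrite ler0n.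
(* After replacing [Q] by the smaller [X], the bound [2 * (m - 1) / n%:R <= s%:R] absorbs the
   negative part of [y], and [a > 0] makes the result strict. *)
have main : 0 < 2 * (m - 1) / n%:R * X * y + s%:R * (e * A * W ^+ 2) * Q.
  have kap0 : 0 < 2 * (m - 1) / n%:R by rewrite divr_gt0// mulr_gt0// subr_gt0.
  apply: (@lt_le_trans _ _
    (X * (2 * (m - 1) / n%:R * y + s%:R * (e * A * W ^+ 2)))); last first.
    rewrite mulrDr; apply: lerD; first by rewrite mulrCA mulrA.
    by rewrite mulrC ler_wpM2l// !mulr_ge0// ltW.
  apply: mulr_gt0 => //.
  apply: (@lt_le_trans _ _ (2 * (m - 1) / n%:R * (e * (a - A) * W ^+ 2)
    + s%:R * (e * A * W ^+ 2))); last first.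
    by rewrite lerD2r ler_pM2l.
  rewrite [ltRHS](_ : _ = (2 * (m - 1) / n%:R * a
    + (s%:R - 2 * (m - 1) / n%:R) * A) * e * W ^+ 2); last by ring.
  rewrite !pmulr_lgt0//; apply: ltr_pwDl; [exact: mulr_gt0|].
  by rewrite mulr_ge0 ?subr_ge0// ltW.
rewrite -(pmulr_rgt0 _ W2).
have TE' : T = (F + lambda / (m + n%:R - 1) + e * A * W ^+ 2) / W ^+ 2.
  by apply: (mulIf (lt0r_neq0 W2)); rewrite -TE mulfVK ?lt0r_neq0//; ring.
have DE' : D = (lambda - mu * W ^+ 2 + (m + n%:R - 1) * F) / W.
  by rewrite -DE mulrAC mulfV// mul1r.
move: main; congr (0 < _).
rewrite /X /Q DE /y TE' DE' -!natr1.
by field; rewrite Wn0 nn0 Nn0 m1n0.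
Qed.

(** * From charts to the manifold *)

Section Atlas.
Context {R : realType} {n : nat} {M : smooth_manifold R n}.

Lemma chart_map_cts (a : chart R n M) p : chart_dom a p ->
  {for p, continuous (chart_map a)}.
Proof.
move=> ap; have := @chart_map_continuous _ _ _ a.
by rewrite continuous_open_subspace; [apply; rewrite inE|exact: chart_dom_open].
Qed.

Lemma chart_inv_cts (a : chart R n M) x : chart_cod a x ->
  {for x, continuous (chart_inv a)}.
Proof.
move=> ax; have := @chart_inv_continuous _ _ _ a.
by rewrite continuous_open_subspace; [apply; rewrite inE|exact: chart_cod_open].
Qed.

Lemma overlap_open (a b : chart R n M) : open (overlap a b).
Proof.
rewrite openE => x [ax bx]; apply: filterI.
  by apply: open_nbhs_nbhs; split => //; exact: chart_cod_open.
apply: (chart_inv_cts ax); apply: open_nbhs_nbhs; split => //.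
exact: chart_dom_open.
Qed.

(** Turns a quantity given by chart formulas into a function on the manifold, to which compactness
    can be applied; each point is assigned a chosen chart. *)
Lemma atlas_glue (T : Type) (F : chart R n M -> 'rV[R]_n -> T) (t0 : T) :
  (forall a b, atlas a -> atlas b -> forall x, overlap a b x ->
    F a x = F b (transition a b x)) ->
  exists G : M -> T, forall a p, atlas a -> chart_dom a p ->
    G p = F a (chart_map a p).
Proof.
move=> FE; have /choice[c cP] : forall p : M, exists a, atlas a /\ chart_dom a p.
  by move=> p; have [a] := atlas_cover p; exists a.
exists (fun p => F (c p) (chart_map (c p) p)) => a p aa ap.
have [acp cpp] := cP p; rewrite (FE _ _ acp aa) /transition ?chart_mapK//.
by split; [exact: chart_map_cod|rewrite chart_mapK].
Qed.

Lemma atlas_continuous (G : M -> R) :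
  (forall a, atlas a -> exists2 f : 'rV[R]_n -> R,
    smooth_on (chart_cod a) f &
    forall p, chart_dom a p -> G p = f (chart_map a p)) ->
  continuous G.
Proof.
move=> H p; have [a aa ap] := atlas_cover p; have [f sf fE] := H a aa.
have cf : {for chart_map a p, continuous f}.
  exact: smooth_on_continuous sf (chart_map_cod ap).
have cfm : {for p, continuous (f \o chart_map a)}.
  exact: continuous_comp (chart_map_cts ap) cf.
have nG : \forall q \near p, (f \o chart_map a) q = G q.
  have : \forall q \near p, chart_dom a q.
    by apply: open_nbhs_nbhs; split => //; exact: chart_dom_open.
  by apply: filterS => q aq; rewrite fE.
rewrite /prop_for /continuous_at fE//.
exact: cvg_trans (near_eq_cvg nG) cfm.
Qed.
End Atlas.

Section Metric.
Context {R : realType} {n : nat} {M : riemannian_manifold R n}.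

Lemma metric_smooth_mx (a : chart R n M) : atlas a ->
  smooth_mx (chart_cod a) (metric a).
Proof. by move=> aa i j; exact: metric_smooth. Qed.

Lemma metric_posdef_mx (a : chart R n M) : atlas a ->
  forall x, chart_cod a x -> posdef_mx (metric a x).
Proof.
by move=> aa x ax; split; [exact: (Defs.metric_sym aa ax)|exact: (metric_posdef aa ax)].
Qed.

(** The differential and the metric transform by the same Jacobian [J], which cancels against its
    inverse. Invertibility of [J] is read off from that of [metric a], without differentiating the
    inverse transition. *)
Lemma grad_norm2_transition (f : M -> R) : smooth f ->
  forall a b, atlas a -> atlas b -> forall x, overlap a b x ->
  grad_norm2 (metric a) (f \o chart_inv a) x =
  grad_norm2 (metric b) (f \o chart_inv b) (transition a b x).
Proof.
move=> sf a b aa ab x abx; have [ax bx] := abx.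
have btx : chart_cod b (transition a b x) := chart_map_cod bx.
pose J : 'M[R]_n := \matrix_(i, k) partial i (fun y => transition a b y 0 k) x.
have sb := sf b ab.
have [db Db] := smooth_on_differentiable (@chart_cod_open _ _ _ b) sb btx.
have dfE : gradient_row (f \o chart_inv a) x =
    gradient_row (f \o chart_inv b) (transition a b x) *m J^T.
  apply/rowP => i; rewrite [LHS]mxE.
  have E y : overlap a b y ->
      (f \o chart_inv a) y = ((f \o chart_inv b) \o transition a b) y.
    by move=> [_ aby] /=; rewrite /transition chart_mapK.
  rewrite (eq_on_partial i (@overlap_open _ _ M a b) abx E) partial_comp//; last first.
    by move=> k; exact: smooth_on_derivable (atlas_smooth aa ab k) abx.
  rewrite -deriveE// Db [RHS]mxE; apply: eq_bigr => k _.
  by rewrite !mxE mulrC.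
have gE : metric a x = J *m metric b (transition a b x) *m J^T.
  apply/matrixP => i j; rewrite (metric_tensor aa ab abx) [RHS]mxE.
  rewrite exchange_big; apply: eq_bigr => l _; rewrite [X in X * _]mxE mulr_suml.
  by apply: eq_bigr => k _; rewrite !mxE mulrAC.
have ua := posdef_unitmx (metric_posdef_mx aa ax).
have ub := posdef_unitmx (metric_posdef_mx ab btx).
have uJ : J \in unitmx.
  by move: ua; rewrite gE unitmx_mul => /andP[]; rewrite unitmx_mul => /andP[].
rewrite (grad_norm2E (metric_posdef_mx aa))// (grad_norm2E (metric_posdef_mx ab))//.
rewrite dfE; move: ua; rewrite gE.
move: (gradient_row _ _) (metric b _) ub => d B ub uA.
have -> : d *m J^T *m invmx (J *m B *m J^T) = d *m invmx B *m invmx J.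
  rewrite -[RHS](mulmxK uA) !mulmxA mulmxKV// (mulmxKV ub).
  by [].
by rewrite trmx_mul trmxK mulmxA mulmxKV.
Qed.
End Metric.

(** With [b = lambda / N], adding F to this polynomial in w gives [w^2] times the excess of
    [(F + b) / w^2 + e w^s] over [T]. Clearing the denominator leaves only polynomials in w to
    differentiate. *)
Definition barrier_poly (R : comNzRingType) (s : nat) (b e T : R) : {poly R} :=
  b%:P + e *: 'X^(s.+2) - T *: 'X^2.

Section BarrierPoly.
Context {R : comNzRingType} (s : nat) (b e T t : R).

Lemma barrier_polyE :
  (barrier_poly s b e T).[t] = b + e * t ^+ s.+2 - T * t ^+ 2.
Proof. by rewrite /barrier_poly !hornerE. Qed.

Let derivE : (barrier_poly s b e T)^`() =
  e *: ('X^(s.+1) *+ s.+2) - T *: ('X *+ 2).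
Proof.
by rewrite /barrier_poly derivB derivD derivC !derivZ !derivXn add0r expr1.
Qed.

Lemma deriv_barrier_polyE : (barrier_poly s b e T)^`().[t] =
  s.+2%:R * e * t ^+ s.+1 - 2 * T * t.
Proof.
rewrite derivE hornerD hornerN !hornerZ !hornerMn hornerXn hornerX.
rewrite -mulr_natl; ring.
Qed.

Lemma deriv2_barrier_polyE : (barrier_poly s b e T)^`()^`().[t] =
  s.+2%:R * s.+1%:R * e * t ^+ s - 2 * T.
Proof.
rewrite derivE derivB !derivZ !derivMn derivXn derivX.
rewrite hornerD hornerN !hornerZ !hornerMn hornerXn hornerC.
rewrite -(mulr_natl _ s.+2) -(mulr_natl _ s.+1) mulr2n /=; ring.
Qed.
End BarrierPoly.

(** * The maximum argument on the compact manifold *)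

Section QuasiEinstein.
Context {R : realType} {n : nat} {k c d : R}.
Context {X : smooth_metric_measure_space n k}.
Hypothesis X_qe : quasi_einstein X c.
Hypothesis X_char : characteristic_constant X c d.

Lemma wc_gt0 (a : chart R n X) x : 0 < wc a x.
Proof. exact: density_gt0. Qed.

Lemma wc_smooth (a : chart R n X) : atlas a -> smooth_on (chart_cod a) (wc a).
Proof. exact: density_smooth. Qed.

Lemma wc_chart_map (a : chart R n X) p : chart_dom a p ->
  wc a (chart_map a p) = density p.
Proof. by move=> ap; rewrite /wc chart_mapK. Qed.

Lemma density_continuous : continuous (@density _ _ _ X).
Proof.
apply: atlas_continuous => a aa; exists (wc a); first exact: wc_smooth.
by move=> p ap; rewrite wc_chart_map.
Qed.

Lemma density_laplacian_chart (a : chart R n X) x : atlas a -> chart_cod a x ->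
  wc a x * laplacian (metric a) (wc a) x =
  d - c * wc a x ^+ 2 + (1 - k) * grad_norm2 (metric a) (wc a) x.
Proof.
move=> aa ax.
exact: (density_laplacian (@chart_cod_open _ _ _ a) (metric_posdef_mx aa)
  (wc_smooth aa) (fun x _ => wc_gt0 a x) (X_qe aa) (dim_param_neq0 X) (X_char aa) ax).
Qed.

Lemma scalar_curvature_chart (a : chart R n X) x : atlas a -> chart_cod a x ->
  scalar_curvature a x = (n%:R - k) * c + k * d / wc a x ^+ 2
  - k * (k - 1) * grad_norm2 (metric a) (wc a) x / wc a x ^+ 2.
Proof.
move=> aa ax.
exact: (trace_ricci_grad (@chart_cod_open _ _ _ a) (metric_posdef_mx aa)
  (wc_smooth aa) (fun x _ => wc_gt0 a x) (X_qe aa) (dim_param_neq0 X) (X_char aa) ax).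
Qed.

Lemma compact_max (f : X -> R) : compact [set: X] -> X -> continuous f ->
  exists p, forall q, f q <= f p.
Proof.
move=> cX p0 cf.
have X0 : [set: X] !=set0 by exists p0.
have wf : {within [set: X], continuous f} by exact: continuous_subspaceT.
have [p _ pmax] := compact_EVT_max X0 cX wf.
by exists p => q; apply: pmax; rewrite inE.
Qed.

(* At a maximum of the density w, [w * Lap w = d - c w^2] is nonpositive. *)
Lemma quasi_einstein_constant_gt0 : compact [set: X] -> X -> 0 < d -> 0 < c.
Proof.
move=> cX p0 d0.
have [p pmax] := compact_max cX p0 density_continuous.
have [a aa ap] := atlas_cover p; pose x := chart_map a p.
have ax : chart_cod a x := chart_map_cod ap.
have wmax y : chart_cod a y -> wc a y <= wc a x.
  by move=> ay; rewrite (wc_chart_map ap); exact: pmax.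
have Lw := laplacian_local_max (@chart_cod_open _ _ _ a) (metric_posdef_mx aa)
  (wc_smooth aa) ax wmax.
have F0 : grad_norm2 (metric a) (wc a) x = 0.
  rewrite (grad_norm2E (metric_posdef_mx aa))//.
  have -> : gradient_row (wc a) x = 0.
    apply/rowP => i; rewrite !mxE.
    exact: (local_max_partial (@chart_cod_open _ _ _ a) i (wc_smooth aa) ax wmax).
  by rewrite !mul0mx mxE.
have := density_laplacian_chart aa ax; rewrite F0 mulr0 addr0 => E.
have : d - c * wc a x ^+ 2 <= 0 by rewrite -E pmulr_rle0// wc_gt0.
rewrite subr_le0 => /(lt_le_trans d0).
by rewrite pmulr_lgt0// exprn_gt0// wc_gt0.
Qed.

End QuasiEinstein.

Theorem corollary4p28 (R : realType) (n : nat) (n_gt0 : (0 < n)%N)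
    (m : R) (m_gt1 : 1 < m)
    (X : smooth_metric_measure_space n (2 - m - n%:R))
    (X_compact : compact [set: X])
    (mu lambda : R)
    (X_qe : quasi_einstein X mu)
    (X_char : characteristic_constant X mu lambda)
    (lambda_gt0 : 0 < lambda) :
  forall a : chart R n X, atlas a -> forall p : X, chart_dom a p ->
    - (n%:R * (n%:R - 1) / (m - 1) * mu) < scalar_curvature a (chart_map a p)
    /\ scalar_curvature a (chart_map a p) <= (m + 2 * n%:R - 2) * mu.
Proof.
move=> a0 aa0 q a0q.
have mu0 := quasi_einstein_constant_gt0 X_qe X_char X_compact q lambda_gt0.
have n0 : 0 < n%:R :> R by rewrite ltr0n.
have nge1 : 1 <= n%:R :> R by rewrite ler1n.
pose V (a : chart R n X) := grad_norm2 (metric a) (wc a).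
have V0 (a : chart R n X) x : atlas a -> chart_cod a x -> 0 <= V a x.
  by move=> aa ax; exact: (grad_norm2_ge0 (metric_posdef_mx aa)).
pose x0 := chart_map a0 q; have ax0 : chart_cod a0 x0 := chart_map_cod a0q.
have w0 := wc_gt0 a0 x0; have W2 : 0 < wc a0 x0 ^+ 2 by rewrite exprn_gt0.
have RE := scalar_curvature_chart X_qe X_char aa0 ax0.
rewrite -/x0; split; last first.
  have V1 : 0 <= V a0 x0 / wc a0 x0 ^+ 2 by rewrite divr_ge0 ?V0// ltW.
  have L1 : 0 <= lambda / wc a0 x0 ^+ 2 by rewrite divr_ge0 ?ltW.
  rewrite RE -!mulrA -/(V a0 x0).
  move: (V a0 x0 / _) (lambda / _) V1 L1 => v l v0 l0.
  (* Both factors are negative, so the gradient term lowers the scalar curvature; so does the term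
     in [lambda], since its coefficient is [2 - m - n]. *)
  have kk : 0 <= (2 - m - n%:R) * (2 - m - n%:R - 1) by nra.
  by have := mulr_ge0 kk v0; nra.
rewrite ltNge; apply/negP => Rle.
pose N := m + n%:R - 1; have N0 : 0 < N by rewrite /N; lra.
pose al := mu / (m - 1); have al0 : 0 < al by rewrite divr_gt0// subr_gt0.
have N1 : 0 < N - 1 by rewrite /N; lra.
have qle : al <= (V a0 x0 + lambda / N) / wc a0 x0 ^+ 2.
  rewrite -subr_le0 -(pmulr_rle0 _ (mulr_gt0 N0 N1)).
  have <- : scalar_curvature a0 x0 + n%:R * (n%:R - 1) / (m - 1) * mu =
      N * (N - 1) * (al - (V a0 x0 + lambda / N) / wc a0 x0 ^+ 2).
    have m1 : m - 1 != 0 by rewrite subr_eq0 gt_eqF.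
    rewrite RE -/(V a0 x0) /al /N; field.
    by rewrite gt_eqF//= m1 (gt_eqF N0).
  by rewrite -lerBrDr sub0r.
have sV (a : chart R n X) : atlas a -> smooth_on (chart_cod a) (V a).
  move=> aa; apply: smooth_grad_norm2.
  - exact: chart_cod_open.
  - exact: metric_smooth_mx.
  - exact: metric_posdef_mx.
  - exact: wc_smooth.
have [G GE] : exists G : X -> R, forall a p, atlas a -> chart_dom a p ->
    G p = V a (chart_map a p).
  apply: (atlas_glue 0) => a b aa ab x abx.
  exact: (grad_norm2_transition (@density_smooth _ _ _ X) aa ab abx).
have cG : continuous G.
  apply: atlas_continuous => a aa; exists (V a); first exact: sV.
  by move=> p ap; rewrite (GE a).
have cw : continuous (@density _ _ _ X) := density_continuous.
have [p1 p1max] := compact_max X_compact q cw.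
have kap0 : 0 < 2 * (m - 1) / n%:R by rewrite divr_gt0// mulr_gt0// subr_gt0.
(* The summands are positive, so this one bound yields both lower bounds on [s] in
   [barrier_contradiction]. *)
have [s sbig] : exists s : nat, m + n%:R + 2 * (m - 1) / n%:R <= s%:R.
  exists (Num.bound (m + n%:R + 2 * (m - 1) / n%:R)).
  by apply/ltW/archi_boundP; lra.
pose W1 := density p1 ^+ s; have W10 : 0 < W1 by rewrite exprn_gt0// density_gt0.
(* Chosen so that [N * e * W1 = n%:R * al / 2]. Since [W1] bounds [w^s] everywhere, the smallness
   condition holds wherever the maximum of [Th] turns out to lie. *)
pose e := n%:R * al / (2 * N * W1).
have two0 : 0 < 2 :> R by rewrite ltr0n.
have e0 : 0 < e := divr_gt0 (mulr_gt0 n0 al0) (mulr_gt0 (mulr_gt0 two0 N0) W10).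
pose Th (p : X) := (G p + lambda / N) / density p ^+ 2 + e * density p ^+ s.
have cX i : continuous (fun p : X => density p ^+ i).
  move=> p; apply: (@continuous_comp _ _ _ (@density _ _ _ X) (fun t => t ^+ i)).
    exact: cw.
  exact: exprn_continuous.
have cTh : continuous Th.
  move=> p; have dn0 : density p ^+ 2 != 0 by rewrite expf_neq0// gt_eqF// density_gt0.
  exact: (cvgD (cvgM (cvgD (cG p) (cvg_cst _)) (cvgV dn0 (cX 2 p)))
    (cvgM (cvg_cst _) (cX s p))).
have [p pmax] := compact_max X_compact q cTh.
have [a aa ap] := atlas_cover p; pose x := chart_map a p.
have ax : chart_cod a x := chart_map_cod ap.
pose T := Th p.
pose P := barrier_poly s (lambda / N) e T.
have PE t : P.[t] = lambda / N + e * t ^+ s.+2 - T * t ^+ 2 := barrier_polyE _ _ _ _ _.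
have wx0 : 0 < wc a x by exact: wc_gt0.
have YE y : chart_cod a y ->
    V a y + P.[wc a y] = (Th (chart_inv a y) - T) * wc a y ^+ 2.
  move=> ay; have wy0 : wc a y != 0 by rewrite gt_eqF// wc_gt0.
  rewrite PE /Th (GE a _ aa (chart_inv_dom ay)) chart_invK//.
  rewrite -/(wc a y) !exprS expr0; field.
  by rewrite wy0 gt_eqF.
have Ymax0 : V a x + P.[wc a x] = 0.
  by rewrite YE// /x chart_mapK// subrr mul0r.
(* Multiplication by the nonconstant factor [w^2] preserves this maximum because [T] has been
   subtracted, which makes the maximal value 0. *)
have Ymax y : chart_cod a y -> V a y + P.[wc a y] <= V a x + P.[wc a x].
  move=> ay; rewrite Ymax0 YE// pmulr_lle0 ?exprn_gt0 ?wc_gt0//.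
  by rewrite subr_le0 pmax.
have := max_inequality (@chart_cod_open _ _ _ a) (metric_smooth_mx aa)
  (metric_posdef_mx aa) (wc_smooth aa) (fun x _ => wc_gt0 a x) (X_qe a aa)
  (dim_param_neq0 X) (X_char a aa) n_gt0 ax Ymax.
rewrite deriv_barrier_polyE deriv2_barrier_polyE -/(V a x) => H.
have DE := density_laplacian_chart X_qe X_char aa ax.
have kE : 2 - m - n%:R - 2 = - (m + n%:R) by ring.
have kE' : 1 - (2 - m - n%:R) = m + n%:R - 1 by ring.
rewrite kE in H; rewrite kE' in DE.
have Wle : wc a x ^+ s <= W1.
  rewrite (wc_chart_map ap) /W1; apply: lerXn2r (p1max p); rewrite nnegrE;
  exact: ltW (density_gt0 _).
apply: (@barrier_contradiction R n s m mu lambda (wc a x) (V a x)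
  (laplacian (metric a) (wc a) x) T e (density q ^+ s)) => //.
- exact: V0.
- by rewrite exprn_gt0// density_gt0.
- by lra.
- by lra.
- by move/eqP: Ymax0; rewrite PE addrA subr_eq0 addrA => /eqP.
(* The point [q] where the strict bound was assumed to fail is used here: it forces [T] above [al]
   by at least [e * density q ^+ s]. *)
- rewrite -/al; apply: le_trans (pmax q); rewrite /Th (GE a0)// lerD2r.
  by move: qle; rewrite (wc_chart_map a0q).
- rewrite -/N -/al; apply: (@le_lt_trans _ _ (N * e * W1)).
    by rewrite ler_wpM2l// ltW// mulr_gt0.
  rewrite [ltLHS](_ : _ = n%:R * al / 2); last first.
    by rewrite /e; field; rewrite !gt_eqF.
  by have := mulr_gt0 n0 al0; move: (n%:R * al) => z z0; lra.
Qed.
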